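(* Consider the queue size process $(Q(t), t\in\mathbb{Z}_+)$ of the switched queueing network operated under the MaxWeight-$(\alpha,g)$ policy, as defined in the context. If the vector of average arrival rates $\bar a$ belongs to the interior of $\langle\mathcal{S}\rangle$, then the queue size process $(Q(t), t\in\mathbb{Z}_+)$ is positive recurrent.
   Context: Notation: $\mathbb{N}=\{1,2,\dots\}$, $\mathbb{Z}_+=\{0,1,2,\dots\}$, $\mathbb{R}_+=[0,\infty)$; $q\wedge s=\min\{q,s\}$ for real numbers, applied componentwise to vectors; $\langle A\rangle$ denotes the set of convex combinations of points of a finite set $A\subset\mathbb{R}^{\mathcal{J}}$. Network: $\mathcal{J}$ is a finite set indexing the queues. The numbers of arrivals at the queues at time $t$, $a(t)=(a_j(t):j\in\mathcal{J})\in\mathbb{Z}_+^{\mathcal{J}}$, $t\in\mathbb{N}$, form a sequence of independent identically distributed random vectors with finite mean $\bar a\in(0,\infty)^{\mathcal{J}}$ and finite variance, $\mathbb{E}[a_j(t)^2]\le K$ for all $j\in\mathcal{J}$, where $K<\infty$ is a constant. The set of schedules $\mathcal{S}\subset\mathbb{Z}_+^{\mathcal{J}}$ is finite and contains the zero vector; for $\sigma=(\sigma_j:j\in\mathcal{J})\in\mathcal{S}$, $\sigma_j$ is the number of jobs that will be served from queue $j$ under schedule $\sigma$. The set $\langle\mathcal{S}\rangle$ has non-empty interior. For $Q\in\mathbb{Z}_+^{\mathcal{J}}$, $\mathcal{S}\wedge Q=\{\sigma\wedge Q:\sigma\in\mathcal{S}\}$. Policy: $\alpha$ is a positive real number and,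 for each $j\in\mathcal{J}$, $g_j:\mathbb{R}_+\to\mathbb{R}$ is a strictly increasing, differentiable, strictly concave function. Given the queue size vector $Q(t-1)=(Q_j(t-1):j\in\mathcal{J})\in\mathbb{Z}_+^{\mathcal{J}}$, let $\bar\sigma(t)$ be a solution to the optimization: maximize $$\sum_{j\in\mathcal{J}} g_j(s_j)\,Q_j(t-1)^\alpha\quad\text{over } s\in\langle\mathcal{S}\wedge Q(t-1)\rangle .$$ The MaxWeight-$(\alpha,g)$ policy chooses at each time $t\in\mathbb{N}$ a random schedule $\sigma(t)$ with support on $\mathcal{S}\wedge Q(t-1)$ and mean $\bar\sigma(t)$ (given $Q(t-1)$). Each $\sigma(t)$ is a function of $Q(t-1)$ and an independent uniform random variable (these uniform random variables being independent of each other and of the arrivals). From an initial state $Q(0)\in\mathbb{Z}_+^{\mathcal{J}}$ the queue sizes evolve by $$Q_j(t+1)=Q_j(t)-\sigma_j(t+1)+a_j(t+1),\qquad j\in\mathcal{J},\ t\in\mathbb{Z}_+,$$ so that $(Q(t), t\in\mathbb{Z}_+)$ is a discrete-time Markov chain on $\mathbb{Z}_+^{\mathcal{J}}$. *)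

(* Defs.v *)
From HB Require Import structures.
From mathcomp Require Import all_boot all_order all_algebra finmap.
From mathcomp Require Import all_classical all_reals all_analysis.

Set Implicit Arguments.
Unset Strict Implicit.
Unset Printing Implicit Defensive.

Import Order.TTheory GRing.Theory Num.Theory.
Import numFieldNormedType.Exports.

Local Open Scope classical_set_scope.
Local Open Scope ring_scope.

Definition state (J : finType) := {ffun J -> nat}.

HB.instance Definition _ (J : finType) := Countable.on (state J).
HB.instance Definition _ (J : finType) :=
  isPointed.Build (state J) [ffun=> 0%N].
(* The countable set [state J] carries the discrete sigma-algebra. *)
HB.instance Definition _ (J : finType) :=
  @isMeasurable.Build default_measure_display (state J)
    discrete_measurable discrete_measurable0
    discrete_measurableC discrete_measurableU.

Section network.
Context {R : realType} {J : finType}.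

Definition hull (A : {fset state J}) : set {ptws J -> R} :=
  [set x | exists w : state J -> R,
    [/\ forall p, p \in A -> 0 <= w p,
        \sum_(p <- A) w p = 1 &
        forall j, x j = \sum_(p <- A) w p * (p j)%:R]].

Definition meet (s q : state J) : state J := [ffun j => minn (s j) (q j)].

Definition cap (S : {fset state J}) (q : state J) : {fset state J} :=
  [fset meet s q | s in S]%fset.

(* At the end point 0 the difference quotient is one-sided. *)
Definition differentiable_Rplus (f : R -> R) :=
  forall x : R, 0 <= x ->
    cvg ((f y - f x) / (y - x) @[y --> within `[0, +oo[ x^']).

Definition strictly_increasing_Rplus (f : R -> R) :=
  forall x y : R, 0 <= x -> x < y -> f x < f y.

Definition strictly_concave_Rplus (f : R -> R) :=
  forall x y t : R, 0 <= x -> 0 <= y -> x != y -> 0 < t < 1 ->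
    t * f x + (1 - t) * f y < f (t * x + (1 - t) * y).

Definition objective (alpha : R) (g : J -> R -> R) (q : state J) (s : J -> R) :=
  \sum_(j : J) g j (s j) * (q j)%:R `^ alpha.

Definition optimal alpha g S q (s : {ptws J -> R}) :=
  hull (cap S q) s /\
  forall s', hull (cap S q) s' -> objective alpha g q s' <= objective alpha g q s.

(* [phi q u] is the random schedule chosen in state [q], as a function of the
   value [u] of a random variable uniform on [0, 1]. *)
Record maxweight alpha g S (phi : state J -> R -> state J) : Prop := MaxWeight {
  maxweight_measurable : forall q, measurable_fun setT (phi q) ;
  maxweight_support : forall q,
    uniform_prob (@ltr01 R) (phi q @^-1` [set` cap S q]) = 1%E ;
  maxweight_mean : forall q, exists2 s, optimal alpha g S q s &
    forall j, ('E_(uniform_prob (@ltr01 R))[fun u => (phi q u j)%:R] = (s j)%:E)%E }.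

(* Queue sizes started from [q0].  [a t] and [U t] are the arrivals and the
   randomisation of the slot leading from time [t] to time [t.+1].  The
   subtraction is truncated, which only matters on the null event where
   [phi q (U t)] exceeds [q]. *)
Fixpoint queue {T : Type} (phi : state J -> R -> state J)
    (a : nat -> T -> state J) (U : nat -> T -> R)
    (q0 : state J) (t : nat) (w : T) : state J :=
  if t is t'.+1 then
    let q := queue phi a U q0 t' w in
    [ffun j => (q j - phi q (U t' w) j + a t' w j)%N]
  else q0.

End network.

Section probability.
Context {d : measure_display} {T : measurableType d} {R : realType}.
Variable P : probability T R.

(* Mutual independence of a family of systems of events. *)
Definition independent {I : choiceType} (F : I -> set_system T) :=
  forall (s : {fset I}) (E : I -> set T),
    (forall i, i \in s -> F i (E i)) ->
    P (\bigcap_(i in [set` s]) E i) = (\prod_(i <- s) P (E i))%E.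

Definition sigma_of {d'} {T' : measurableType d'} (X : T -> T') : set_system T :=
  preimage_set_system setT X measurable.

(* Least time [n >= m] at which the path is in [A], [+oo] if there is none. *)
Definition first_time {V : Type} (m : nat) (X : nat -> T -> V) (A : set V)
    (w : T) : \bar R :=
  ereal_inf [set (n%:R)%:E | n in [set n | (m <= n)%N /\ A (X n w)]].

(* A Markov chain is given by its paths [X x] from every initial state [x]. *)
Section chain.
Context {V : Type}.
Variable X : V -> nat -> T -> V.

Definition recurrent_state (x : V) :=
  P [set w | (first_time 1 (X x) [set x] w < +oo)%E] = 1%E.

Definition positive_recurrent_state (x : V) :=
  recurrent_state x /\ (\int[P]_w first_time 1 (X x) [set x] w < +oo)%E.

(* No irreducibility is assumed: there may be transient states and several
   closed communicating classes.  All recurrent states have to be positive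
   recurrent, and the recurrent states are reached in finite mean time from
   everywhere.  For an irreducible chain this says that every state is positive
   recurrent. *)
Definition positive_recurrent :=
  (forall x, recurrent_state x -> positive_recurrent_state x) /\
  (forall x, \int[P]_w first_time 0 (X x) recurrent_state w < +oo)%E.

End chain.
End probability.

(* Main.v *)
(* Let [c_j > 0] be a supergradient of [g_j] at [abar_j].  Comparing the chosen mean
   schedule [s] with a point [(1 + z) abar] of the hull, truncated at [q], concavity gives
   [sum_j c_j q_j^alpha (abar_j - s_j) <= C - e sum_j q_j^alpha].  This would give a
   negative drift to [sum_j c_j q_j^(1 + alpha)], which however may have infinite mean
   after one step, as the arrivals only have two moments.  The Lyapunov function is
   therefore the root of order [1 + alpha] of that sum, a weighted norm: arrivals are
   truncated at a level [B], the tangent-line inequality applies to the truncated step, and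
   the truncation costs [O(1/B)] since the norm is Lipschitz and the second moments are
   bounded.  So some finite set is reached in finite mean time from everywhere.  The chain
   may be reducible: from such a set [F], any target accessible from every point of [F] is
   reached in finite mean time by geometric trials, which is applied to the recurrent
   states, and to a single recurrent state inside the closed set of states it leads to. *)

Require Import Defs.
From HB Require Import structures.
From mathcomp Require Import all_boot all_order all_algebra finmap.
From mathcomp Require Import all_classical all_reals all_analysis.
From mathcomp Require Import measurable_realfun ring lra.

Import Order.TTheory GRing.Theory Num.Theory.
Import numFieldNormedType.Exports.

Local Open Scope classical_set_scope.
Local Open Scope ring_scope.

(** * Countable Markov chains *)

(** The Lyapunov step must work for every [alpha > 0]. For [alpha < 1] the second derivative of x^(1
    + alpha) is unbounded near 0, so no second-order expansion is used: convexity of the mass is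
    applied with the gradient at the end point of the step, concavity of the root at its starting
    point, and both are exact first-order inequalities. Moving the gradient back to the starting
    point costs a small multiple of the sum of the q_j^alpha plus a constant. The slope of the root
    divides everything by the norm to the power [alpha], which is at most a multiple of that same
    sum; this is how a drift proportional to the sum becomes a drift bounded away from 0. On the
    side of the chain, [surv] and [hit_mean] are built from iterates of the kernel with extended
    real values, so that means can be bounded before they are known to be finite. Paths are tied to
    the kernel by one identity, between an integral over the paths avoiding a set and an iterated
    taboo operator. *)

Section countable_chain.
Set Implicit Arguments.
Unset Strict Implicit.
Local Open Scope ereal_scope.
Context {R : realType} {d : measure_display} {V : measurableType d}.
Hypothesis discr : forall A : set V, measurable A.
Hypothesis cntV : countable [set: V].
Variable mu : V -> probability V R.
Implicit Types (A D F : set V) (f g : V -> \bar R) (x y z : V).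

Let mf D f : measurable_fun D f. Proof. by move=> ? B _; exact: discr. Qed.

Definition step f x := \int[mu x]_y f y.

(** The transition operator killed on entering [A]. The starting state is not tested, so a start in
    [A] leads to return times. *)
Definition taboo A f := step (f \_ (~` A)).

Lemma step_ge0 f x : (forall y, 0 <= f y) -> 0 <= step f x.
Proof. by move=> f0; exact: integral_ge0. Qed.

Lemma le_step f g x : (forall y, 0 <= f y) -> (forall y, f y <= g y) ->
  step f x <= step g x.
Proof. by move=> f0 fg; apply: ge0_le_integral. Qed.

Lemma stepD f g x : (forall y, 0 <= f y) -> (forall y, 0 <= g y) ->
  step (fun y => f y + g y) x = step f x + step g x.
Proof. by move=> f0 g0; exact: ge0_integralD. Qed.

Lemma step_cst c x : step (cst c) x = c.
Proof. by rewrite /step integral_cst//= probability_setT mule1. Qed.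

Lemma step_nneseries (f : nat -> V -> \bar R) x :
  (forall n y, 0 <= f n y) ->
  step (fun y => \sum_(n <oo) f n y) x = \sum_(n <oo) step (f n) x.
Proof. by move=> f0; apply: integral_nneseries. Qed.

Lemma taboo_ge0 A f x : (forall y, 0 <= f y) -> 0 <= taboo A f x.
Proof. by move=> f0; apply: step_ge0 => y; apply: erestrict_ge0. Qed.

Lemma le_taboo A f g x : (forall y, 0 <= f y) ->
  (forall y, ~ A y -> f y <= g y) -> taboo A f x <= taboo A g x.
Proof.
move=> f0 fg; apply: le_step => y; first exact: erestrict_ge0.
by rewrite !patchE; case: ifPn => // /set_mem; exact: fg.
Qed.

Lemma eq_taboo A f g x : (forall y, ~ A y -> f y = g y) ->
  taboo A f x = taboo A g x.
Proof.
move=> fg; congr step; apply/funext => y.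
by rewrite !patchE; case: ifPn => // /set_mem; exact: fg.
Qed.

Lemma taboo_le_step A f x : (forall y, 0 <= f y) -> taboo A f x <= step f x.
Proof.
move=> f0; apply: le_step => y; first exact: erestrict_ge0.
by rewrite patchE; case: ifP.
Qed.

Lemma tabooD A f g x : (forall y, 0 <= f y) -> (forall y, 0 <= g y) ->
  taboo A (fun y => f y + g y) x = taboo A f x + taboo A g x.
Proof.
move=> f0 g0; rewrite -stepD; [|by move=> y; apply: erestrict_ge0..].
by congr step; apply/funext => y; rewrite !patchE; case: ifP => //; rewrite adde0.
Qed.

Lemma tabooZ A (c : R) f x : (0 <= c)%R -> (forall y, 0 <= f y) ->
  taboo A (fun y => c%:E * f y) x = c%:E * taboo A f x.
Proof.
move=> c0 f0; rewrite /taboo/step -ge0_integralZl//; last first.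
  by move=> y _; exact: erestrict_ge0.
by congr integral; apply/funext => y; rewrite !patchE; case: ifP => //; rewrite mule0.
Qed.

Lemma taboo_sum A n (f : nat -> V -> \bar R) x : (forall n y, 0 <= f n y) ->
  taboo A (fun y => \sum_(0 <= i < n) f i y) x = \sum_(0 <= i < n) taboo A (f i) x.
Proof.
move=> f0; elim: n => [|n IH].
  rewrite big_geq// /taboo/step integral0_eq// => y _.
  by rewrite patchE big_geq//; case: ifP.
rewrite big_nat_recr//= -IH -tabooD//; last by move=> y; exact: sume_ge0.
by apply: eq_taboo => y _; rewrite big_nat_recr.
Qed.

Lemma taboo_nneseries A (f : nat -> V -> \bar R) x : (forall n y, 0 <= f n y) ->
  taboo A (fun y => \sum_(n <oo) f n y) x = \sum_(n <oo) taboo A (f n) x.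
Proof.
move=> f0; rewrite -step_nneseries; last by move=> *; exact: erestrict_ge0.
congr step; apply/funext => y; rewrite patchE; case: ifPn => yA.
  by apply: eq_eseriesr => n _; rewrite patchE yA.
by rewrite eseries0// => n _ _; rewrite patchE (negbTE yA).
Qed.

(* [surv A n x] is the probability, starting at [x], of avoiding [A] at the times [1 .. n];
   so [hit_mean A x] is the mean of the first time [>= 1] in [A]. *)
Definition surv A n := iter n (taboo A) (cst 1).

Lemma survS A n : surv A n.+1 = taboo A (surv A n). Proof. by []. Qed.

Definition hit_mean A x := \sum_(n <oo) surv A n x.

(** The mean of the hitting time truncated at [n]. It is finite, which allows bounds by induction on
    [n] that then pass to the limit. *)
Definition hit_trunc A n x := \sum_(0 <= i < n) surv A i x.

Lemma iter_taboo_ge0 A n f x : (forall y, 0 <= f y) -> 0 <= iter n (taboo A) f x.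
Proof. by move=> f0; elim: n x => [|n IH] x //=; exact: taboo_ge0. Qed.

Lemma le_iter_taboo A n f g x : (forall y, 0 <= f y) -> (forall y, f y <= g y) ->
  iter n (taboo A) f x <= iter n (taboo A) g x.
Proof.
move=> f0 fg; elim: n x => [|n IH] x //=.
by apply: le_taboo => y *; [exact: iter_taboo_ge0|exact: IH].
Qed.

Lemma iter_tabooD A n f g x : (forall y, 0 <= f y) -> (forall y, 0 <= g y) ->
  iter n (taboo A) (fun y => f y + g y) x =
  iter n (taboo A) f x + iter n (taboo A) g x.
Proof.
move=> f0 g0; elim: n x => [|n IH] x //=.
rewrite -tabooD; [|by move=> *; apply: iter_taboo_ge0..].
by apply: eq_taboo => y _; exact: IH.
Qed.

Lemma iter_taboo_cst A n (c : R) x : (0 <= c)%R ->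
  iter n (taboo A) (cst c%:E) x = c%:E * surv A n x.
Proof.
move=> c0; elim: n x => [|n IH] x; first by rewrite /= mule1.
rewrite iterS (eq_taboo (g := fun y => c%:E * surv A n y))// tabooZ//.
by move=> y; exact: iter_taboo_ge0.
Qed.

Lemma surv_ge0 A n x : 0 <= surv A n x.
Proof. exact: iter_taboo_ge0. Qed.

Lemma surv_leS A n x : surv A n.+1 x <= surv A n x.
Proof.
elim: n x => [|n IH] x; last first.
  by apply: le_taboo => y *; [exact: (surv_ge0 A n.+1 y)|exact: IH].
by rewrite /= (le_trans (taboo_le_step _ _ _))// step_cst.
Qed.

Lemma surv_nincr A x m n : (m <= n)%N -> surv A n x <= surv A m x.
Proof.
move=> /subnK <-; elim: (n - m)%N => // k IH.
by rewrite addSn (le_trans (surv_leS _ _ _)).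
Qed.

Lemma surv_le1 A n x : surv A n x <= 1.
Proof. exact: (@surv_nincr A x 0 n isT). Qed.

Lemma surv_fin A n x : surv A n x \is a fin_num.
Proof.
by rewrite ge0_fin_numE ?surv_ge0// (le_lt_trans (surv_le1 _ _ _)) ?ltry.
Qed.

Lemma hit_trunc_ge0 A n x : 0 <= hit_trunc A n x.
Proof. by apply: sume_ge0 => i _; exact: surv_ge0. Qed.

Lemma hit_mean_ge0 A x : 0 <= hit_mean A x.
Proof. by apply: nneseries_ge0 => i _ _; exact: surv_ge0. Qed.

Lemma hit_truncS A n x : hit_trunc A n.+1 x = 1 + taboo A (hit_trunc A n) x.
Proof.
rewrite /hit_trunc big_nat_recl//= taboo_sum// => *; exact: surv_ge0.
Qed.

Lemma hit_trunc_leq A m n x : (m <= n)%N -> hit_trunc A m x <= hit_trunc A n x.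
Proof. by move=> mn; apply: lee_sum_nneg_natr => // *; exact: surv_ge0. Qed.

Lemma hit_trunc_le A n x : hit_trunc A n x <= n%:R%:E.
Proof.
rewrite /hit_trunc (le_trans (lee_sum _ (fun i _ => surv_le1 A i x)))//.
by rewrite sumEFin lee_fin big_const_nat iter_addr_0 subn0.
Qed.

Lemma hit_truncD A m n x :
  hit_trunc A (m + n) x = hit_trunc A m x + iter m (taboo A) (hit_trunc A n) x.
Proof.
elim: m x => [|m IH] x; first by rewrite [hit_trunc A 0 x]big_geq// add0e.
rewrite addSn !hit_truncS -addeA -tabooD; [|exact: hit_trunc_ge0|]; last first.
  by move=> y; apply: iter_taboo_ge0 => *; exact: hit_trunc_ge0.
by congr (_ + _); apply: eq_taboo => y _; exact: IH.
Qed.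

Lemma hit_mean_le A x M : (forall n, hit_trunc A n x <= M) -> hit_mean A x <= M.
Proof.
move=> h; apply: lime_le; last exact: nearW.
by apply: is_cvg_nneseries => *; exact: surv_ge0.
Qed.

Lemma hit_meanE A x : hit_mean A x = 1 + taboo A (hit_mean A) x.
Proof.
rewrite taboo_nneseries; last exact: surv_ge0.
rewrite /hit_mean nneseries_recl//; last by move=> *; exact: surv_ge0.
rewrite -(@nneseries_addn _ (surv A ^~ x) 1)//; last by move=> *; exact: surv_ge0.
by congr (_ + _); apply: eq_eseriesr => n _; rewrite addn1.
Qed.

(** By induction on [n], [W] bounds [hit_trunc F n] off [F], because [taboo] only looks at states
    off [F]. The first step is taken apart, since the start may lie in [F], where no drift is
    assumed. *)
Lemma foster F (W : V -> \bar R) : (forall x, 0 <= W x) ->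
  (forall x, ~ F x -> 1 + step W x <= W x) ->
  forall x, hit_mean F x <= 1 + step W x.
Proof.
move=> W0 Wdrift.
have tW n x : ~ F x -> hit_trunc F n x <= W x.
  elim: n x => [|n IH] x Fx; first by rewrite /hit_trunc big_geq.
  apply: le_trans (Wdrift _ Fx); rewrite hit_truncS leeD2l//.
  rewrite (le_trans _ (taboo_le_step F x W0))//.
  by apply: le_taboo => y; [exact: hit_trunc_ge0|exact: IH].
move=> x; apply: hit_mean_le => -[|n].
  by rewrite /hit_trunc big_geq// adde_ge0// step_ge0.
rewrite hit_truncS leeD2l// (le_trans _ (taboo_le_step F x W0))//.
by apply: le_taboo => y; [exact: hit_trunc_ge0|exact: tW].
Qed.

(** A step landing off [F] is accounted for by [hit_meanE]; a step landing in [F] starts a new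
    return time, which costs at most [C]. *)
Lemma step_hit_mean F (C : R) x : (0 <= C)%R ->
  (forall y, F y -> hit_mean F y <= C%:E) ->
  step (hit_mean F) x <= hit_mean F x + C%:E.
Proof.
move=> C0 FC; have m0 := hit_mean_ge0 F.
have -> : step (hit_mean F) x = taboo F (hit_mean F) x + taboo (~` F) (hit_mean F) x.
  rewrite -stepD; [|by move=> y; apply: erestrict_ge0..].
  congr step; apply/funext => y; rewrite !patchE setCK in_setC.
  by case: (boolP (y \in F)) => _; rewrite ?adde0 ?add0e.
rewrite leeD//; first by rewrite [leRHS]hit_meanE leeDr.
rewrite -[leRHS](step_cst _ x) (le_trans _ (taboo_le_step (~` F) _ _))//.
by apply: le_taboo => // y; rewrite /setC/= => /contrapT; exact: FC.
Qed.

Lemma iter_step_hit_mean F (C : R) n x : (0 <= C)%R ->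
  (forall y, F y -> hit_mean F y <= C%:E) ->
  iter n step (hit_mean F) x <= hit_mean F x + (n%:R * C)%:E.
Proof.
move=> C0 FC; have m0 := hit_mean_ge0 F; elim: n x => [|n IH] x /=.
  by rewrite mul0r adde0.
rewrite (le_trans (@le_step _ _ x _ IH))//.
  by elim: n {IH} => [|n IH] y //=; exact: step_ge0.
rewrite stepD//; last by move=> _; rewrite lee_fin mulr_ge0.
rewrite (step_cst (n%:R * C)%:E) -natr1 mulrDl mul1r (addrC (n%:R * C)%R).
by rewrite EFinD addeA leeD2r// step_hit_mean.
Qed.

Lemma iter_taboo_le_step A n f x : (forall y, 0 <= f y) ->
  iter n (taboo A) f x <= iter n step f x.
Proof.
move=> f0; elim: n x => [|n IH] x //=.
have it0 y : 0 <= iter n (taboo A) f y by exact: iter_taboo_ge0.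
by rewrite (le_trans (taboo_le_step A x it0))// le_step.
Qed.

(** Wait for [F], then restart towards [D]. Truncating at the same [n] before and after the restart
    lets a one-step induction replace the strong Markov property. *)
Lemma hit_trunc_split F D n (M : R) x : (0 <= M)%R ->
  (forall y, F y -> hit_trunc D n y <= M%:E) ->
  hit_trunc D n x <= hit_mean F x + M%:E.
Proof.
move=> M0; have m0 := hit_mean_ge0 F.
elim: n x => [|n IH] x FM.
  by rewrite /hit_trunc big_geq// adde_ge0.
have {}IH y : hit_trunc D n y <= hit_mean F y + M%:E.
  by apply: IH => z /FM; apply: le_trans; exact: hit_trunc_leq.
rewrite hit_truncS hit_meanE -addeA leeD2l//.
rewrite -[X in _ + X](step_cst _ x) -stepD//; last first.
  by move=> y; apply: erestrict_ge0.
apply: le_step => y; first by apply: erestrict_ge0 => *; exact: hit_trunc_ge0.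
rewrite !patchE; case: ifPn => _; last by rewrite adde_ge0//; case: ifP.
case: ifPn => [_|]; first exact: IH.
rewrite notin_setE /setC/= => /contrapT /FM; rewrite add0e; apply: le_trans.
exact: hit_trunc_leq.
Qed.

(** Survival probabilities decrease in time, so the largest of finitely many times and the smallest
    of the gaps serve for all of [F]. *)
Lemma uniform_escape F D : finite_set F ->
  (forall x, F x -> exists n, surv D n x < 1) ->
  exists n, exists2 c : R, (0 < c)%R & forall x, F x -> surv D n x <= (1 - c)%:E.
Proof.
move=> /finite_seqP[s ->] {F}; elim: s => [|y s IH] h.
  by exists 0%N; exists 1%R.
have [|n [c c0 nc]] := IH; first by move=> x xs; apply: h; rewrite /= inE xs orbT.
have [|m my] := h y; first by rewrite /= mem_head.
have [r r0 mr] : exists2 r : R, (0 < r)%R & surv D m y <= (1 - r)%:E.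
  exists (1 - fine (surv D m y))%R.
    by rewrite subr_gt0 -lte_fin fineK ?surv_fin.
  by rewrite opprB addrCA subrr addr0 fineK ?surv_fin.
exists (maxn m n); exists (Num.min c r); first by rewrite lt_min c0.
move=> x; rewrite /= inE => /orP[/eqP ->|xs].
  rewrite (le_trans (surv_nincr _ _ (leq_maxl _ _)))// (le_trans mr)// lee_fin.
  by rewrite lerD2l lerN2 ge_min lexx orbT.
rewrite (le_trans (surv_nincr _ _ (leq_maxr _ _)))// (le_trans (nc _ xs))// lee_fin.
by rewrite lerD2l lerN2 ge_min lexx.
Qed.

(* From [F] the chain meets [D] within [n] steps with probability at least [c], and the
   mean time from one trial to the next is bounded.  The bound [M] below solves
   [M = n + (C + n C) + (1 - c) M]. *)
Lemma hit_mean_finite F D : finite_set F ->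
  (forall x, hit_mean F x < +oo) ->
  (forall x, F x -> exists n, surv D n x < 1) ->
  forall x, hit_mean D x < +oo.
Proof.
move=> finF meanF Desc.
have [n [c c0 nc]] := uniform_escape finF Desc.
have [C C0 FC] : exists2 C : R, (0 <= C)%R & forall y, F y -> hit_mean F y <= C%:E.
  have /finite_seqP[s sE] := finF.
  exists (\sum_(y <- s) fine (hit_mean F y))%R.
    by apply: sumr_ge0 => y _; rewrite fine_ge0// hit_mean_ge0.
  move=> y Fy; rewrite -[leLHS]fineK; last by rewrite ge0_fin_numE ?hit_mean_ge0.
  have : y \in s by move: Fy; rewrite sE.
  rewrite lee_fin; elim: s {sE} => // z s IH; rewrite inE big_cons.
  move=> /predU1P[<-|/IH h].
    by rewrite lerDl; apply: sumr_ge0 => *; rewrite fine_ge0// hit_mean_ge0.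
  by rewrite (le_trans h)// lerDr fine_ge0// hit_mean_ge0.
pose M := ((n%:R + (C + n%:R * C)) / c)%R.
have M0 : (0 <= M)%R by rewrite divr_ge0 ?addr_ge0 ?mulr_ge0// ltW.
have FM k x : F x -> hit_trunc D (k * n) x <= M%:E.
  elim: k x => [|k IH] x Fx; first by rewrite mul0n /hit_trunc big_geq.
  rewrite mulSn hit_truncD.
  have m0 := hit_mean_ge0 F.
  rewrite (@le_trans _ _ (n%:R%:E + iter n (taboo D) (fun y => hit_mean F y + M%:E) x))//.
    rewrite leeD ?hit_trunc_le// le_iter_taboo//; first exact: hit_trunc_ge0.
    by move=> y; exact: hit_trunc_split.
  rewrite (@iter_tabooD D n (hit_mean F) (cst M%:E))// iter_taboo_cst//.
  rewrite (@le_trans _ _ (n%:R%:E + ((C + n%:R * C)%:E + (M * (1 - c))%:E)))//.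
    rewrite leeD2l// leeD//.
      rewrite (le_trans (iter_taboo_le_step D n x m0))//.
      rewrite (le_trans (iter_step_hit_mean n x C0 FC))//.
      by rewrite EFinD leeD2r// FC.
    by rewrite (EFinM M) lee_wpmul2l ?nc // lee_fin.
  have Mc : (M * c = n%:R + (C + n%:R * C))%R by rewrite divfK ?gt_eqF.
  by rewrite -!EFinD lee_fin mulrBr mulr1 Mc; lra.
(* For [n = 0] the blocks [k * n] do not grow; but [surv D 0] is 1, so the escape bound then forces
   [F] to be empty. *)
have [n0|n_gt0] := posnP n.
  move=> x; apply: le_lt_trans (meanF x); apply: hit_mean_le => k.
  have F0 : forall y, ~ F y.
    move=> y /nc; rewrite n0/= lee_fin leNgt => /negP; apply.
    by rewrite ltrBlDr ltrDl.
  have := @hit_trunc_split F D k 0 x; rewrite adde0; apply=> //.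
  by move=> y /F0.
move=> x; apply: (@le_lt_trans _ _ (hit_mean F x + M%:E)); last first.
  by rewrite lte_add_pinfty// ltry.
apply: hit_mean_le => k; apply: hit_trunc_split => // y Fy.
apply: le_trans (FM k _ Fy); apply: hit_trunc_leq.
by rewrite leq_pmulr.
Qed.

Inductive reach : V -> V -> Prop :=
| reach_refl x : reach x x
| reach_step x y z : 0 < mu x [set y] -> reach y z -> reach x z.

Lemma reach_trans x y z : reach x y -> reach y z -> reach x z.
Proof. by elim=> // a b c ab _ IH /IH; exact: reach_step. Qed.

Lemma mass_null A x : (forall y, A y -> mu x [set y] = 0) -> mu x A = 0.
Proof.
move=> A0; have /countable_injP[code codeI] := cntV.
pose G k := A `&` [set y | code y = k].
have AE : A = \bigcup_k G k.
  by apply/seteqP; split=> [y Ay|y [k _] []]//; exists (code y).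
apply/negligibleP; first exact: discr.
rewrite AE; apply: negligible_bigcup => k; apply/negligibleP; first exact: discr.
have [->|/set0P[y [Ay yk]]] := eqVneq (G k) set0; first by rewrite measure0.
suff -> : G k = [set y] by exact: A0.
apply/seteqP; split=> [z [_ /= zk]|z ->]//=; apply: codeI; rewrite ?inE//.
by rewrite zk yk.
Qed.

Lemma step_eq f g x : (forall y, 0 < mu x [set y] -> f y = g y) ->
  step f x = step g x.
Proof.
move=> fg; apply: ae_eq_integral => //.
apply/negligibleP; first exact: discr.
apply: mass_null => y /= /not_implyP[_ /eqP fgy]; apply/eqP.
rewrite eq_le measure_ge0 andbT leNgt; apply: contra_neqN fgy; exact: fg.
Qed.

Lemma successor x : exists y, 0 < mu x [set y].
Proof.
apply: contrapT => /forallNP h.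
have : mu x setT = 0.
  apply: mass_null => y _; apply/eqP; rewrite eq_le measure_ge0 andbT leNgt.
  exact/negP.
by rewrite probability_setT => /eqP; rewrite onee_eq0.
Qed.

Lemma step_ge_mass f x y : (forall z, 0 <= f z) -> f y * mu x [set y] <= step f x.
Proof.
move=> f0; rewrite -(setIT [set y]) -integral_indic//.
rewrite -ge0_integralZl//.
apply: ge0_le_integral => // z _.
  by rewrite mule_ge0.
by rewrite indicE; case: (boolP (z \in _)) => [/set_mem ->|_]; rewrite ?mule1// mule0.
Qed.

Lemma step_lt1 f x y : (forall z, 0 <= f z) -> (forall z, f z <= 1) ->
  0 < mu x [set y] -> f y < 1 -> step f x < 1.
Proof.
move=> f0 f1 xy fy.
have ffin z : f z \is a fin_num by rewrite ge0_fin_numE// (le_lt_trans (f1 z)) ?ltry.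
have gE : step f x + step (fun z => 1 - f z) x = 1.
  rewrite -stepD//; last by move=> z; rewrite sube_ge0 ?f1 ?ffin.
  rewrite -[RHS](step_cst _ x); congr step; apply/funext => z /=.
  by rewrite addeC subeK.
have : 0 < step (fun z => 1 - f z) x.
  apply: lt_le_trans (@step_ge_mass _ x y _); last by move=> z; rewrite sube_ge0 ?f1 ?ffin.
  by rewrite mule_gt0// sube_gt0.
move=> g0; rewrite -[ltRHS]gE lteDl// ge0_fin_numE; last exact: step_ge0.
rewrite (@le_lt_trans _ _ 1) ?ltry// -[leRHS](step_cst _ x); exact: le_step.
Qed.

(** The restriction off [D] gives survival 0 to a start in [D], as the path of length zero
    requires. *)
Lemma reach_escape D x y : reach x y -> D y -> exists n, (surv D n \_ (~` D)) x < 1.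
Proof.
elim=> {x y} [x|x y z xy _ IH] Dx.
  by exists 0%N; rewrite patchE in_setC mem_set.
have [n ny] := IH Dx; exists n.+1; rewrite patchE; case: ifPn => // _.
apply: step_lt1 xy ny => u; first by apply: erestrict_ge0 => *; exact: surv_ge0.
by rewrite patchE; case: ifP => // _; exact: surv_le1.
Qed.

Lemma escape_step D x y : 0 < mu x [set y] -> (exists2 z, reach y z & D z) ->
  exists n, surv D n x < 1.
Proof.
move=> xy [z yz Dz]; have [n ny] := reach_escape yz Dz; exists n.+1.
apply: step_lt1 xy ny => u; first by apply: erestrict_ge0 => *; exact: surv_ge0.
by rewrite patchE; case: ifP => // _; exact: surv_le1.
Qed.

Lemma eq_surv A D x : (forall y, reach x y -> (A y <-> D y)) ->
  forall n, surv A n x = surv D n x.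
Proof.
move=> h n; have : reach x x by exact: reach_refl.
elim: n {2 3 4}x => [//|n IH] y xy.
rewrite !survS; apply: step_eq => z yz.
have xz : reach x z by apply: reach_trans xy _; apply: reach_step yz (reach_refl _).
rewrite !patchE !in_setC.
have -> : (z \in A) = (z \in D).
  by apply/idP/idP => /set_mem/(h _ xz)/mem_set.
by case: ifP => // _; exact: IH.
Qed.

Lemma surv_unreach A x : (forall y, reach x y -> ~ A y) -> forall n, surv A n x = 1.
Proof.
move=> h n; rewrite (@eq_surv A set0 x); last by move=> y /h.
elim: n x {h} => // n IH x /=; rewrite -[RHS](step_cst _ x); congr step.
by apply/funext => y; rewrite patchE setC0 in_setT IH.
Qed.

Lemma hit_reach A x : hit_mean A x < +oo -> exists2 y, reach x y & A y.
Proof.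
move=> hx; apply: contrapT => h.
have h1 : forall n, surv A n x = 1.
  by apply: surv_unreach => y xy Ay; apply: h; exists y.
suff : hit_mean A x = +oo by move=> E; rewrite E in hx.
rewrite /hit_mean (eq_eseriesr (g := fun=> 1)); last by move=> i _; exact: h1.
apply/eqyP => r r0.
rewrite (le_trans _ (@nneseries_lim_ge _ (fun=> 1) xpredT 0 (Num.truncn r).+1 _))//.
rewrite sumEFin lee_fin big_const_nat iter_addr_0 subn0.
by rewrite ltW// truncnS_gt.
Qed.

(** Transience of [z] in terms of the kernel: the survival probabilities do not decrease to 0. *)
Definition escapes z := exists2 c : R, (0 < c)%R & forall n, c%:E <= surv [set z] n z.

(** Were there no way back from [y], following a fixed path to [y] would avoid [z] for ever with
    positive probability. The start of the path is generalised to [x] to allow induction along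
    it. *)
Lemma reach_sym z y : ~ escapes z -> reach z y -> reach y z.
Proof.
move=> zr zy; apply: contrapT => nyz.
suff : exists2 c : R, (0 < c)%R & forall n, c%:E <= surv [set z] n z by [].
move: zy; move: {1 3}z => x xy.
have y1 : forall n, surv [set z] n y = 1.
  by apply: surv_unreach => u yu uz; apply: nyz; rewrite -uz.
elim: xy y1 nyz => [u u1 _|u v w uv _ IH w1 nwz].
  by exists 1%R => // n; rewrite u1.
have [c c0 cv] := IH w1 nwz.
(* If the path passes through [z] again, the bound for its tail is already an escape from [z]. *)
have [vz|vz] := pselect (v = z).
  by case: zr; exists c => // n; have := cv n; rewrite vz.
have mfin : mu u [set v] \is a fin_num by exact: fin_num_measure.
exists (c * Num.min 1 (fine (mu u [set v])))%R.
  by rewrite mulr_gt0// lt_min ltr01/= fine_gt0// uv ltey_eq mfin.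
case=> [|n]; rewrite /=.
  rewrite lee_fin (@le_trans _ _ c)//; first by rewrite ler_piMr ?ge_min ?lexx// ltW.
  by have := cv 0%N; rewrite /= lee_fin.
rewrite (@le_trans _ _ (c%:E * mu u [set v]))//.
  rewrite -[X in _ <= _ * X]fineK// -EFinM lee_fin ler_pM2l//.
  by rewrite ge_min lexx orbT.
rewrite (le_trans _ (@step_ge_mass _ u v _))//; last first.
  by move=> ?; apply: erestrict_ge0 => *; exact: surv_ge0.
by rewrite lee_wpmul2r// patchE in_setC memNset//= cv.
Qed.

Lemma return_mean_finite F z : finite_set F -> (forall x, hit_mean F x < +oo) ->
  (forall y, F y -> reach z y -> reach y z) -> hit_mean [set z] z < +oo.
Proof.
move=> finF meanF back.
(* The states that [z] does not reach make the target accessible from everywhere, and do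
   not change the time at which it is hit from [z]. *)
pose D := [set z] `|` [set y | ~ reach z y].
suff : hit_mean D z < +oo.
  congr (_ < _); apply: eq_eseriesr => n _; apply: eq_surv => y zy.
  by split=> [[]//|yz]; left.
apply: (hit_mean_finite finF meanF) => x Fx.
have [y xy] := successor x; apply: escape_step xy _.
have [zy|nzy] := pselect (reach z y); last first.
  by exists y; [exact: reach_refl|right].
have [u yu Fu] := hit_reach (meanF y).
by exists z; [apply: (reach_trans yu); apply: back => //; exact: reach_trans zy yu|left].
Qed.

Lemma leads_to_finite_mean F x : finite_set F -> (forall x, hit_mean F x < +oo) ->
  exists2 z, reach x z & hit_mean [set z] z < +oo.
Proof.
move=> finF meanF; have /finite_seqP[s sE] := finF.
(* Take a state of [F] reachable from [x] that leads to as few states of [F] as possible. *)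
pose cnt y := count (fun u => `[< reach y u >]) s.
have [y xy Fy] := hit_reach (meanF x).
have exP : exists k, `[< exists z, [/\ reach x z, F z & cnt z = k] >].
  by exists (cnt y); apply/asboolP; exists y.
case: (ex_minnP exP) => k /asboolP[z [xz Fz zk]] kmin.
exists z => //; apply: (return_mean_finite finF meanF) => u Fu zu.
apply: contrapT => nuz.
have : (k <= cnt u)%N.
  by apply: kmin; apply/asboolP; exists u; split => //; exact: reach_trans zu.
(* All that [u] reaches is reached by [z], and [z] itself is lost, so the count drops strictly. *)
apply/negP; rewrite -ltnNge -zk /cnt.
have zs : z \in s by move: Fz; rewrite sE.
have sub : subpred (fun v => `[< reach u v >]) (fun v => `[< reach z v >]).
  by move=> v /asboolP uv; apply/asboolP; exact: reach_trans zu uv.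
elim: s zs {sE exP kmin zk cnt} => // v s IH; rewrite inE /= => /predU1P[<-|/IH lt].
  rewrite (asboolF nuz) (asboolT (reach_refl z)) add0n add1n ltnS.
  exact: sub_count.
rewrite -addnS leq_add//; case: (asboolP (reach u v)) => // uv.
by rewrite asboolT//; exact: reach_trans zu uv.
Qed.

End countable_chain.

(** * Hitting times along paths, and the Foster criterion for possibly reducible chains *)

Section hitting_times.
Set Implicit Arguments.
Unset Strict Implicit.
Local Open Scope ereal_scope.
Context {R : realType}.

Lemma nneseries_cst_pinfty (c : R) : (0 < c)%R -> \sum_(n <oo) c%:E = +oo.
Proof.
move=> c0; apply/eqyP => r r0.
pose N := (Num.trunc (r / c)).+1.
rewrite (le_trans _ (@nneseries_lim_ge _ (fun=> c%:E) xpredT 0 N _))//; last first.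
  by move=> *; rewrite lee_fin ltW.
rewrite sumEFin lee_fin big_const_nat iter_addr_0 subn0 -mulr_natr mulrC.
by rewrite -ler_pdivrMr// ltW// truncnS_gt.
Qed.

Definition alive {T V : Type} (Y : nat -> T -> V) (A : set V) (n : nat) : set T :=
  [set w | forall k, (0 < k <= n)%N -> ~ A (Y k w)].

Lemma aliveS {T V : Type} (Y : nat -> T -> V) A n :
  alive Y A n.+1 = alive Y A n `&` (Y n.+1 @^-1` (~` A)).
Proof.
apply/seteqP; split=> [w h|w [h Aw] k /andP[k0]].
  by split=> [k /andP[k0 kn]|]; [apply: h; rewrite k0 ltnW|exact: (h n.+1 (leqnn _))].
rewrite leq_eqVlt => /predU1P[->//|kn]; apply: h; rewrite k0/=.
by rewrite -ltnS.
Qed.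

(** A hitting time counts the instants at which the set has not been hit yet. This turns its mean
    into a series of survival probabilities. *)
Lemma first_timeE {dT} {T : measurableType dT} {V : Type} (Y : nat -> T -> V) A w :
  first_time (R := R) 1 Y A w = \sum_(n <oo) (\1_(alive Y A n) w)%:E.
Proof.
have [[m [m1 Am]]|nohit] := pselect (exists m, (1 <= m)%N /\ A (Y m w)); last first.
  rewrite (eq_eseriesr (g := fun=> 1%:E)); last first.
    move=> n _; rewrite indicE mem_set// => k /andP[k0 _] Ak.
    by apply: nohit; exists k.
  rewrite nneseries_cst_pinfty// /first_time.
  rewrite (_ : [set _ | _ in _] = set0) ?ereal_inf0//.
  by apply/seteqP; split=> // ? [n /= [n1 An]]; case: nohit; exists n.
have exP : exists m, (0 < m)%N && `[< A (Y m w) >].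
  by exists m; rewrite m1; exact/asboolP.
have [{Am}] := ex_minnP exP; move: m m1 => _ _ m /andP[m1 /asboolP Am] mmin.
rewrite (@nneseries_split _ _ 0 m)//.
rewrite big_nat (eq_bigr (fun=> 1%:E)); last first.
  move=> n /andP[_ nm]; rewrite indicE mem_set// => k /andP[k0 kn] Ak.
  have : (m <= k)%N by apply: mmin; rewrite k0; exact/asboolP.
  by rewrite leqNgt (leq_ltn_trans kn nm).
rewrite -big_nat sumEFin big_const_nat iter_addr_0 add0n subn0.
rewrite eseries0 => [|k mk _]; last first.
  rewrite indicE memNset//= => /(_ m); apply => //.
  by rewrite m1.
rewrite adde0; apply/eqP; rewrite eq_le; apply/andP; split.
  by apply: ereal_inf_lbound; exists m.
apply: le_ereal_inf_tmp => _ [n [n1 An] <-]; rewrite lee_fin ler_nat.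
by apply: mmin; rewrite n1; exact/asboolP.
Qed.

Lemma first_time0_in {dT} {T : measurableType dT} {V : Type} (Y : nat -> T -> V) A w :
  A (Y 0%N w) -> first_time (R := R) 0 Y A w = 0.
Proof.
move=> A0; apply/eqP; rewrite eq_le; apply/andP; split.
  by apply: ereal_inf_lbound; exists 0%N.
by apply: le_ereal_inf_tmp => _ [n _ <-].
Qed.

Lemma first_time0_notin {dT} {T : measurableType dT} {V : Type} (Y : nat -> T -> V) A w :
  ~ A (Y 0%N w) -> first_time (R := R) 0 Y A w = first_time 1 Y A w.
Proof.
move=> nA; rewrite /first_time; congr ereal_inf; congr image.
by apply/seteqP; split=> [[|n] []|n []].
Qed.

Lemma first_time_lty {dT} {T : measurableType dT} {V : Type} (Y : nat -> T -> V) A :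
  [set w | first_time (R := R) 1 Y A w < +oo] = ~` \bigcap_n alive Y A n.
Proof.
apply/seteqP; split=> w /= h.
  move=> al; move: h; rewrite first_timeE (eq_eseriesr (g := fun=> 1%:E)).
    by rewrite nneseries_cst_pinfty.
  by move=> n _; rewrite indicE mem_set//; exact: al.
rewrite ltNge; apply: contra_notN h; rewrite leye_eq => /eqP ty n _ k /andP[k0 _] Ak.
have : first_time (R := R) 1 Y A w <= k%:R%:E.
  by apply: ereal_inf_lbound; exists k.
by rewrite ty leye_eq.
Qed.

Context {d : measure_display} {V : measurableType d}.
Hypothesis discr : forall A : set V, measurable A.
Hypothesis cntV : countable [set: V].

(** Cut the domain along the level sets of [code \o Y]. For a code that no state has, [xget] returns
    the default [point], weighted by the measure of the empty set. *)
Lemma discrete_integral {d'} {T : measurableType d'} (P : {measure set T -> \bar R})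
    (code : V -> nat) (E : set T) (Y : T -> V) (g : V -> \bar R) :
  injective code -> measurable E -> measurable_fun setT Y ->
  (forall y, 0 <= g y) ->
  \int[P]_(w in E) g (Y w) = \sum_(k <oo)
    (g (xget point [set y | code y = k]) * P (E `&` (Y @^-1` [set y | code y = k]))).
Proof.
move=> codeI mE mY g0.
pose S k := E `&` (Y @^-1` [set y | code y = k]).
have mS k : measurable (S k).
  by apply: measurableI => //; rewrite -[X in measurable X]setTI; exact: mY.
have ES : E = \bigcup_k S k.
  by apply/seteqP; split=> [w Ew|w [k _] []]//; exists (code (Y w)).
have mg : measurable_fun setT (g \o Y).
  by apply: measurableT_comp => // ? B _; exact: discr.
rewrite {1}ES ge0_integral_bigcup//; last 2 first.
- exact: measurable_funTS.
- by move=> i j _ _ [w [[_ /= wi] [_ /= wj]]]; rewrite -wi -wj.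
apply: eq_eseriesr => k _.
rewrite -/(S k) -integral_cst//; apply: eq_integral => w /set_mem [Ew /= wk].
congr g; case: xgetP => [y -> /= yk|/(_ (Y w))]; last by case.
by apply: codeI; rewrite wk yk.
Qed.

Context {d' : measure_display} {T : measurableType d'} {P : probability T R}.
Variables (mu : V -> probability V R) (X : V -> nat -> T -> V).
Hypothesis X0 : forall x w, X x 0%N w = x.
Hypothesis mX : forall x n, measurable_fun setT (X x n).
(** The Markov property for those past events that hitting times involve: avoidance of a set, with
    the present state prescribed. *)
Hypothesis markov : forall A x n y Z,
  P (alive (X x) A n `&` (X x n @^-1` [set y]) `&` (X x n.+1 @^-1` Z)) =
  P (alive (X x) A n `&` (X x n @^-1` [set y])) * mu y Z.

Let mXpre x n (Z : set V) : measurable (X x n @^-1` Z).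
Proof. by rewrite -[X in measurable X]setTI; exact: mX. Qed.

Lemma measurable_alive A x n : measurable (alive (X x) A n).
Proof.
elim: n => [|n IH]; last by rewrite aliveS; exact: measurableI.
rewrite (_ : alive _ _ _ = setT)//; apply/seteqP; split=> // w _ k /andP[].
by case: k.
Qed.

Lemma integral_step A x n y (g : V -> \bar R) : (forall z, 0 <= g z) ->
  \int[P]_(w in alive (X x) A n `&` (X x n @^-1` [set y])) g (X x n.+1 w) =
  P (alive (X x) A n `&` (X x n @^-1` [set y])) * step mu g y.
Proof.
move=> g0; have /countable_injP[code codeI'] := cntV.
have codeI : injective code by move=> a b; apply: codeI'; rewrite inE.
have mE : measurable (alive (X x) A n `&` (X x n @^-1` [set y])).
  by apply: measurableI => //; exact: measurable_alive.
rewrite (discrete_integral P codeI)//.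
rewrite /step (discrete_integral (mu y) codeI (Y := id))//.
have Efin : P (alive (X x) A n `&` (X x n @^-1` [set y])) \is a fin_num.
  exact: fin_num_measure.
rewrite -(fineK Efin) -nneseriesZl; last by move=> k _; rewrite mule_ge0.
apply: eq_eseriesr => k _; rewrite fineK// setTI muleCA; congr (_ * _).
exact: markov.
Qed.

(** Slicing by the state at time [n] peels off the last step, which is absorbed into the integrand;
    hence the induction is for all [f]. *)
Lemma integral_alive A x n (f : V -> \bar R) : (forall y, 0 <= f y) ->
  \int[P]_(w in alive (X x) A n) f (X x n w) = iter n (taboo mu A) f x.
Proof.
have mf D (g : V -> \bar R) : measurable_fun D g by move=> ? B _; exact: discr.
have mfX k (g : V -> \bar R) : measurable_fun setT (g \o X x k) by exact: measurableT_comp.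
elim: n f => [|n IH] f f0.
  rewrite /= (_ : alive _ _ _ = setT); last first.
    by apply/seteqP; split=> // w _ k /andP[]; case: k.
  rewrite -[RHS]mule1 -(probability_setT P) -integral_cst//.
  by apply: eq_integral => w _; rewrite X0.
have t0 y : 0 <= taboo mu A f y by exact: taboo_ge0.
rewrite iterSr -IH//.
pose g := f \_ (~` A); have g0 y : 0 <= g y by exact: erestrict_ge0.
transitivity (\int[P]_(w in alive (X x) A n) g (X x n.+1 w)).
  rewrite aliveS integral_mkcondr; apply: eq_integral => w _.
  by rewrite /g !patchE; congr (if _ then _ else _); apply/idP/idP => /set_mem/mem_set.
have /countable_injP[code codeI'] := cntV.
have codeI : injective code by move=> a b; apply: codeI'; rewrite inE.
pose S k := alive (X x) A n `&` (X x n @^-1` [set y | code y = k]).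
have mS k : measurable (S k).
  by apply: measurableI => //; exact: measurable_alive.
have ES : alive (X x) A n = \bigcup_k S k.
  by apply/seteqP; split=> [w Ew|w [k _] []]//; exists (code (X x n w)).
have tS : trivIset setT S.
  by move=> i j _ _ [w [[_ /= wi] [_ /= wj]]]; rewrite -wi -wj.
rewrite ES !ge0_integral_bigcup//; try by [exact: measurable_funTS (mfX _ _)|move=> ? _; exact: t0].
apply: eq_eseriesr => k _.
have [[y yk]|nok] := pselect (exists y, code y = k); last first.
  rewrite (_ : S k = set0) ?integral_set0//; apply/seteqP; split=> // w [_ /= wk].
  by apply: nok; exists (X x n w).
have -> : S k = alive (X x) A n `&` (X x n @^-1` [set y]).
  apply/seteqP; split=> w [aw /= wk]; split=> //=; first by apply: codeI; rewrite wk yk.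
  by rewrite wk.
rewrite integral_step// muleC -integral_cst.
  by apply: eq_integral => w /set_mem [_ /= ->].
by apply: measurableI => //; exact: measurable_alive.
Qed.

Lemma alive_surv A x n : P (alive (X x) A n) = surv mu A n x.
Proof.
rewrite /surv -integral_alive//.
rewrite integral_cst ?mul1e//; exact: measurable_alive.
Qed.

Lemma integral_first_time A x : \int[P]_w first_time 1 (X x) A w = hit_mean mu A x.
Proof.
under eq_integral do rewrite first_timeE.
rewrite integral_nneseries//; last first.
  move=> n; apply/measurable_EFinP; apply: measurable_indic.
  exact: measurable_alive.
apply: eq_eseriesr => n _; rewrite integral_indic ?setIT;
  [exact: alive_surv|by []|exact: measurable_alive].
Qed.

Let mcap A x : measurable (\bigcap_n alive (X x) A n).
Proof. by apply: bigcapT_measurable => n; exact: measurable_alive. Qed.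

(** Continuity from above carries the lower bound on the survival probabilities over to the event of
    never returning. *)
Lemma recurrent_not_escapes z : recurrent_state P X z -> ~ escapes mu z.
Proof.
rewrite /recurrent_state first_time_lty probability_setC// => h [c c0 hc].
have : c%:E <= P (\bigcap_n alive (X z) [set z] n).
  have : (P \o alive (X z) [set z]) @ \oo --> P (\bigcap_n alive (X z) [set z] n).
    apply: nonincreasing_cvg_mu => //.
    - by rewrite (le_lt_trans (probability_le1 _ _)) ?ltry//; exact: measurable_alive.
    - by move=> n; exact: measurable_alive.
    - move=> m n mn; apply/subsetPset => w al k /andP[k0 km]; apply: al.
      by rewrite k0 (leq_trans km).
  move=> cv; rewrite -(cvg_lim _ cv)//; apply: lime_ge.
    by apply/cvg_ex; eexists; exact: cv.
  by apply: nearW => n /=; rewrite alive_surv.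
move: h; rewrite -{2}(sube0 1); set p := P _.
have pfin : p \is a fin_num by exact: fin_num_measure.
rewrite -(fineK pfin) -!EFinB => -[] /eqP; rewrite (inj_eq (addrI _)) eqr_opp => /eqP ->.
by rewrite lee_fin leNgt c0.
Qed.

(** If never returning had probability [p > 0], all terms of the series [hit_mean] would be at least
    [p]. *)
Lemma hit_mean_recurrent z : hit_mean mu [set z] z < +oo -> recurrent_state P X z.
Proof.
move=> fin; rewrite /recurrent_state first_time_lty probability_setC//.
suff -> : P (\bigcap_n alive (X z) [set z] n) = 0 by rewrite sube0.
apply/eqP; rewrite eq_le measure_ge0 andbT leNgt; apply/negP => p0.
move: fin; apply/negP; rewrite -leNgt.
set p := P _ in p0; have pfin : p \is a fin_num by exact: fin_num_measure.
rewrite -(@nneseries_cst_pinfty (fine p)) ?fine_gt0 ?p0 ?ltey_eq ?pfin//.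
apply: lee_nneseries => [n _ _|n _]; first by rewrite lee_fin fine_ge0// ltW.
rewrite fineK// -alive_surv le_measure ?inE//; first exact: measurable_alive.
by move=> w; apply.
Qed.

Lemma foster_positive_recurrent (F : set V) (W : V -> \bar R) :
  finite_set F -> (forall x, 0 <= W x) -> (forall x, step mu W x < +oo) ->
  (forall x, ~ F x -> 1 + step mu W x <= W x) ->
  positive_recurrent P X.
Proof.
move=> finF W0 Wfin drift.
have meanF x : hit_mean mu F x < +oo.
  rewrite (le_lt_trans (foster discr W0 drift x))//.
  by rewrite lte_add_pinfty// ltry.
split=> [z rz|x].
  split=> //; rewrite integral_first_time.
  apply: (return_mean_finite discr cntV finF meanF) => y _.
  by apply: (reach_sym discr cntV); exact: recurrent_not_escapes.
have [rx|nrx] := pselect (recurrent_state P X x).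
  by rewrite integral0_eq// => w _; rewrite first_time0_in ?X0.
under eq_integral do rewrite first_time0_notin ?X0//.
rewrite integral_first_time.
apply: (hit_mean_finite discr finF meanF) => y Fy.
have [u yu] := successor discr cntV mu y; apply: (escape_step discr yu).
have [z uz zfin] := leads_to_finite_mean discr cntV u finF meanF.
by exists z => //; exact: hit_mean_recurrent.
Qed.

End hitting_times.

(** * The queue sizes form a Markov chain *)

Section queue_markov.
Set Implicit Arguments.
Unset Strict Implicit.
Local Open Scope ereal_scope.
Context {R : realType} {J : finType} {d : measure_display} {T : measurableType d}.
Variables (P : probability T R) (a : nat -> {RV P >-> state J}) (U : nat -> {RV P >-> R}).
Hypothesis a_law : forall s t : nat, distribution P (a s) = distribution P (a t).
Hypothesis U_law : forall t (A : set R), measurable A ->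
  distribution P (U t) A = uniform_prob (@ltr01 R) A.
Hypothesis aU_indep : independent P (fun i : nat + nat =>
  match i with inl t => sigma_of (a t) | inr t => sigma_of (U t) end).
Variable phi : state J -> R -> state J.
Hypothesis mphi : forall q, measurable_fun setT (phi q).
Local Notation code := (@choice.pickle (state J)).

Let codeI : injective code. Proof. exact: pcan_inj (@choice.pickleK _). Qed.

Implicit Types (A : nat -> set (state J)) (B : nat -> set R).

Let ma t (A0 : set (state J)) : measurable (a t @^-1` A0).
Proof. by rewrite -[X in measurable X]setTI; exact: measurable_funP. Qed.

Let mU t (B0 : set R) : measurable B0 -> measurable (U t @^-1` B0).
Proof. by move=> mB; rewrite -[X in measurable X]setTI; exact: measurable_funP. Qed.

Definition slot t (A0 : set (state J)) (B0 : set R) : set T :=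
  (a t @^-1` A0) `&` (U t @^-1` B0).

Fixpoint slots A B n N : set T :=
  if N is N'.+1 then slot n (A n) (B n) `&` slots A B n.+1 N' else setT.

Fixpoint slots_prob A B n N : \bar R :=
  if N is N'.+1 then P (a n @^-1` A n) * P (U n @^-1` B n) * slots_prob A B n.+1 N' else 1.

(* Closed under disjoint unions, so that the past events of the chain can be followed by
   induction on time. *)
Definition indep_future n (G : set T) :=
  measurable G /\ forall A B N, (forall t, measurable (B t)) ->
    P (G `&` slots A B n N) = P G * slots_prob A B n N.

Lemma measurable_slots A B n N : (forall t, measurable (B t)) -> measurable (slots A B n N).
Proof.
move=> mB; elim: N n => [|N IH] n //=.
by apply: measurableI => //; apply: measurableI => //; exact: mU.
Qed.

Lemma eq_slots A B A' B' n N : (forall t, (n <= t)%N -> A t = A' t /\ B t = B' t) ->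
  slots A B n N = slots A' B' n N /\ slots_prob A B n N = slots_prob A' B' n N.
Proof.
elim: N n => [//|N IH] n h /=; have [-> ->] := h n (leqnn _).
by have [|-> ->] := IH n.+1 => // t nt; apply: h; exact: ltnW.
Qed.

Fixpoint slot_indices n N : {fset nat + nat} :=
  if N is N'.+1 then (inl n |` (inr n |` slot_indices n.+1 N'))%fset else fset0.

Lemma slot_indicesP n N i : i \in slot_indices n N ->
  (n <= match i with inl t => t | inr t => t end)%N.
Proof.
elim: N n => [|N IH] n //=; rewrite !in_fset1U => /or3P[/eqP ->|/eqP ->|/IH]//.
exact: ltnW.
Qed.

Lemma slots_indep A B n N : (forall t, measurable (B t)) ->
  P (slots A B n N) = slots_prob A B n N.
Proof.
move=> mB; pose E (i : nat + nat) : set T :=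
  match i with inl t => a t @^-1` A t | inr t => U t @^-1` B t end.
have := aU_indep (s := slot_indices n N) (E := E).
have -> : \bigcap_(i in [set` slot_indices n N]) E i = slots A B n N.
  elim: N n => [|N IH] n /=; first by rewrite set_fset0 bigcap_set0.
  rewrite -IH; apply/seteqP; split=> [w h|w [[wa wU] h] i /=].
    split; first split.
    - by apply: (h (inl n)); rewrite /= in_fset1U eqxx.
    - by apply: (h (inr n)); rewrite /= !in_fset1U eqxx orbT.
    - by move=> i /= iN; apply: h; rewrite /= !in_fset1U iN !orbT.
  by rewrite !in_fset1U => /or3P[/eqP ->|/eqP ->|/h].
have -> : \prod_(i <- slot_indices n N) P (E i) = slots_prob A B n N.
  elim: N n => [|N IH] n /=; first by rewrite big_seq_fset0.
  rewrite !big_fsetU1/= ?IH ?muleA//.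
  - by apply/negP => /slot_indicesP; rewrite ltnn.
  - by rewrite in_fset1U/=; apply/negP => /slot_indicesP; rewrite ltnn.
apply=> -[t|t] _ /=; first by exists (A t) => //; rewrite setTI.
by exists (B t) => //; rewrite setTI.
Qed.

Lemma indep_future_setT n : indep_future n setT.
Proof.
by split=> // A B N mB; rewrite setTI probability_setT mul1e slots_indep.
Qed.

Lemma indep_future_set0 n : indep_future n set0.
Proof. by split=> // A B N mB; rewrite set0I measure0 mul0e. Qed.

(** The event on slot [n] becomes part of the past: the test family is overridden at index [n],
    where the slots from [n.+1] on do not look. *)
Lemma indep_future_slot n G (A0 : set (state J)) (B0 : set R) : measurable B0 -> indep_future n G ->
  indep_future n.+1 (G `&` slot n A0 B0) /\
  P (G `&` slot n A0 B0) = P G * (P (a n @^-1` A0) * P (U n @^-1` B0)).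
Proof.
move=> mB0 [mG indG].
have PE : P (G `&` slot n A0 B0) = P G * (P (a n @^-1` A0) * P (U n @^-1` B0)).
  by have := indG (fun=> A0) (fun=> B0) 1%N (fun=> mB0); rewrite /= setIT mule1.
split=> //; split.
  by apply: measurableI => //; apply: measurableI => //; exact: mU.
move=> A B N mB; rewrite PE -setIA -muleA.
pose A' t := if t == n then A0 else A t; pose B' t := if t == n then B0 else B t.
have mB' t : measurable (B' t) by rewrite /B'; case: ifP.
have [|-> ->] := @eq_slots A B A' B' n.+1 N.
  by move=> t nt; rewrite /A' /B' gtn_eqF.
by have := indG A' B' N.+1 mB'; rewrite /= /A' /B' eqxx.
Qed.

Lemma indep_future_bigcup n (G : nat -> set T) : trivIset setT G ->
  (forall k, indep_future n (G k)) -> indep_future n (\bigcup_k G k).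
Proof.
move=> tG iG; have mG k : measurable (G k) by have [] := iG k.
split; first exact: bigcupT_measurable.
move=> A B N mB; have mS := measurable_slots A n N mB.
rewrite setI_bigcupl !measure_bigcup//; last 2 first.
- by move=> k _; exact: measurableI.
- exact: trivIset_setIr.
rewrite muleC -(@fineK _ (slots_prob A B n N)); last first.
  by rewrite -slots_indep// fin_num_measure.
rewrite -nneseriesZl//.
apply: eq_eseriesr => k _; have [_ /(_ A B N mB) E] := iG k.
by apply: (etrans E); rewrite muleC fineK// -slots_indep// fin_num_measure.
Qed.

Definition queue_step (q : state J) t (w : T) : state J :=
  [ffun j => (q j - phi q (U t w) j + a t w j)%N].

Let arr (q : state J) (Z : set (state J)) k : set (state J) :=
  [set b : state J | exists2 s : state J, code s = k & Z [ffun j => (q j - s j + b j)%N]].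

Let sched q k : set R := [set u | code (phi q u) = k].

Let msched q k : measurable (sched q k).
Proof. by have := mphi q measurableT (Y := [set s | code s = k]); rewrite setTI; apply. Qed.

(** The event is not a rectangle in the pair of [a t] and [U t], to which independence applies
    directly. For a fixed schedule it is one, so it is sliced by the code of the chosen schedule. *)
Lemma next_bigcup q t Z : queue_step q t @^-1` Z = \bigcup_k slot t (arr q Z k) (sched q k).
Proof.
apply/seteqP; split=> [w Zw|w [k _] [[s sk Zs] /= uk]].
  by exists (code (phi q (U t w))) => //; split=> //; exists (phi q (U t w)).
by rewrite /= /queue_step (@codeI (phi q (U t w)) s)// sk.
Qed.

Lemma trivIset_slot q t Z : trivIset setT (fun k => slot t (arr q Z k) (sched q k)).
Proof. by move=> i j _ _ [w [[_ /= <-] [_ /= <-]]]. Qed.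

Lemma indep_next n G q Z : indep_future n G ->
  indep_future n.+1 (G `&` (queue_step q n @^-1` Z)) /\
  P (G `&` (queue_step q n @^-1` Z)) = P G * P (queue_step q 0 @^-1` Z).
Proof.
move=> iG; rewrite !next_bigcup setI_bigcupr.
have tS : trivIset setT (fun k => G `&` slot n (arr q Z k) (sched q k)).
  by move=> i j _ _ [w [[_ [_ /= <-]] [_ [_ /= <-]]]].
have iS k : indep_future n.+1 (G `&` slot n (arr q Z k) (sched q k)).
  by have [] := indep_future_slot (arr q Z k) (msched q k) iG.
split; first exact: indep_future_bigcup.
have mslot t k : measurable (slot t (arr q Z k) (sched q k)).
  by apply: measurableI => //; exact: mU.
rewrite !measure_bigcup//; last 2 first.
- exact: trivIset_slot.
- by move=> k _; have [] := iS k.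
have [mG _] := iG.
rewrite -(@fineK _ (P G)) ?fin_num_measure// -nneseriesZl//.
apply: eq_eseriesr => k _.
have [_ E] := indep_future_slot (arr q Z k) (msched q k) iG.
apply: (etrans E).
have [_] := indep_future_slot (arr q Z k) (msched q k) (indep_future_setT 0).
rewrite setTI probability_setT mul1e => E0.
rewrite fineK ?fin_num_measure//; congr (_ * _); apply: etrans (esym E0).
congr (_ * _).
  exact: (congr1 (fun f => f (arr q Z k)) (a_law n 0)).
by have := U_law n (msched q k); rewrite /distribution/= /pushforward => ->; rewrite -(U_law 0).
Qed.

Let X := queue phi a U.

(** Prescribing the state at time [n] turns the next move into [queue_step] from a fixed state, a
    function of slot [n] alone. The event at time [n.+1] is the disjoint union of these slices. *)
Lemma indep_alive (A0 : set (state J)) x n y :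
  indep_future n (alive (X x) A0 n `&` (X x n @^-1` [set y])).
Proof.
elim: n y => [|n IH] z.
  rewrite (_ : alive _ _ _ = setT); last first.
    by apply/seteqP; split=> // w _ k /andP[]; case: k.
  rewrite setTI; have [->|xz] := eqVneq x z.
    rewrite (_ : _ @^-1` _ = setT); first exact: indep_future_setT.
    by apply/seteqP; split.
  rewrite (_ : _ @^-1` _ = set0); first exact: indep_future_set0.
  by apply/seteqP; split=> // w /= /eqP; rewrite (negbTE xz).
pose G k := alive (X x) A0 n `&` (X x n @^-1` [set y | code y = k]) `&`
  (X x n.+1 @^-1` ([set z] `&` ~` A0)).
have -> : alive (X x) A0 n.+1 `&` (X x n.+1 @^-1` [set z]) = \bigcup_k G k.
  apply/seteqP; split=> w.
    by rewrite aliveS => -[[al nA] /= wz]; exists (code (X x n w)) => //; split.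
  by rewrite aliveS => -[k _ [[al _] [/= wz nA]]]; split.
apply: indep_future_bigcup => [i j _ _ [w [[[_ /= <-] _] [[_ /= <-] _]]]//|k].
have [[y yk]|nok] := pselect (exists y : state J, code y = k); last first.
  rewrite (_ : G k = set0); first exact: indep_future_set0.
  by apply/seteqP; split=> // w [[_ /= wk] _]; apply: nok; exists (X x n w).
have -> : G k = (alive (X x) A0 n `&` (X x n @^-1` [set y])) `&`
    (queue_step y n @^-1` ([set z] `&` ~` A0)).
    apply/seteqP; split=> w [[al /= wk]].
    have {wk} <- : X x n w = y by apply: codeI; rewrite wk yk.
    by [].
  by subst y => h; split.
by have [] := indep_next y ([set z] `&` ~` A0) (IH y).
Qed.

Lemma measurable_queue x n : measurable_fun setT (X x n).
Proof.
move=> _ Z _; rewrite setTI.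
have -> : X x n @^-1` Z = \bigcup_(y in Z) (X x n @^-1` [set y]).
  by apply/seteqP; split=> [w Zw|w [y Zy /= ->]]//; exists (X x n w).
rewrite bigcup_mkcond; apply: countable_bigcupT_measurable => [|y]; first exact: countableP.
case: ifP => // _.
(* With the empty target [alive] is the whole space, and [indep_future] contains the measurability
   of the level set. *)
have [] := indep_alive set0 x n y.
rewrite (_ : alive _ _ _ = setT) ?setTI//.
by apply/seteqP; split=> // w _ k _ [].
Qed.

Definition queue_kernel (x : state J) : probability (state J) R :=
  distribution P (HB.pack (X x 1%N)
    (isMeasurableFun.Build _ _ _ _ _ (measurable_queue x 1)) : {mfun T >-> state J}).

Lemma queue_markov (A0 : set (state J)) x n y Z :
  P (alive (X x) A0 n `&` (X x n @^-1` [set y]) `&` (X x n.+1 @^-1` Z)) =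
  P (alive (X x) A0 n `&` (X x n @^-1` [set y])) * queue_kernel y Z.
Proof.
have [_ <-] := indep_next y Z (indep_alive A0 x n y); congr (P _).
by apply/seteqP; split=> w [[al /= <-] h]; split.
Qed.

Lemma step_queue (f : state J -> \bar R) x : (forall y, 0 <= f y) ->
  step queue_kernel f x = \int[P]_w f (queue_step x 0 w).
Proof.
move=> f0; by rewrite /step ge0_integral_distribution.
Qed.

End queue_markov.

(** * A weighted norm *)

Section power_norm.
Set Implicit Arguments.
Unset Strict Implicit.
Context {R : realType}.
Variable al : R.
Hypothesis al0 : 0 < al.

Let p0 : 0 < 1 + al. Proof. by rewrite addr_gt0. Qed.

Let p0W : 0 <= 1 + al. Proof. exact: ltW. Qed.
Let pV0 : 0 <= (1 + al)^-1. Proof. by rewrite invr_ge0. Qed.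
Let al0W : 0 <= al. Proof. exact: ltW. Qed.

Lemma powR_1D (y : R) : 0 <= y -> y `^ (1 + al) = y * y `^ al.
Proof. by move=> y0; rewrite -(mulr_powRB1 y0 p0) addrC addKr. Qed.

(** Young's inequality for the exponents [1 + al] and [(1 + al) / al]; equivalently, the graph of
    the power [1 + al] lies above its tangent at [y]. *)
Lemma powR_young (x y : R) : 0 <= x -> 0 <= y ->
  (1 + al) * (y `^ al * x) <= x `^ (1 + al) + al * y `^ (1 + al).
Proof.
move=> x0 y0.
have q0 : 0 < (1 + al) / al by rewrite divr_gt0.
have := conjugate_powR x0 (powR_ge0 y al) p0 q0.
rewrite -powRrM mulrCA mulfV ?gt_eqF// mulr1 => /(_ _)/wrap[].
  by rewrite invf_div -{1}(mul1r (1 + al)^-1) -mulrDl mulfV ?gt_eqF.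
rewrite -(ler_pM2l p0) mulrDr (mulrC x) invf_div.
suff -> : (1 + al) * (x `^ (1 + al) / (1 + al)) +
  (1 + al) * (y `^ (1 + al) * (al / (1 + al))) = x `^ (1 + al) + al * y `^ (1 + al) by [].
by field; rewrite gt_eqF.
Qed.

Lemma powR_inv (x : R) : 0 <= x -> (x `^ (1 + al)^-1) `^ (1 + al) = x.
Proof. by move=> x0; rewrite -powRrM mulVf ?gt_eqF// powRr1. Qed.

Lemma ler_powR2 (x y r : R) : 0 <= r -> 0 <= x -> x <= y -> x `^ r <= y `^ r.
Proof. by move=> r0 x0 xy; apply: ge0_ler_powR => //; rewrite nnegrE// (le_trans x0). Qed.

Context {J : finType}.
Variable c : J -> R.
Hypothesis c0 : forall j, 0 < c j.
Let c0W j : 0 <= c j. Proof. exact: ltW. Qed.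

Implicit Types x y z : J -> R.

Definition wmass x : R := \sum_j c j * x j `^ (1 + al).

Definition wnorm x : R := wmass x `^ (1 + al)^-1.

(** The norm of the unit vector in direction [j]. *)
Definition wroot j : R := c j `^ (1 + al)^-1.

Lemma wmass_ge0 x : 0 <= wmass x.
Proof. by apply: sumr_ge0 => j _; rewrite mulr_ge0 ?powR_ge0// ltW. Qed.

Lemma wnorm_ge0 x : 0 <= wnorm x. Proof. exact: powR_ge0. Qed.

Lemma wnormE x : wnorm x `^ (1 + al) = wmass x.
Proof. by rewrite powR_inv// wmass_ge0. Qed.

Lemma wroot_gt0 j : 0 < wroot j. Proof. exact: powR_gt0. Qed.

Let wroot_ge0 j : 0 <= wroot j. Proof. exact/ltW/wroot_gt0. Qed.

Lemma wrootE j : wroot j `^ (1 + al) = c j.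
Proof. by rewrite powR_inv// ltW. Qed.

Lemma wroot_le_wnorm x j : 0 <= x j -> wroot j * x j <= wnorm x.
Proof.
move=> xj0; have d0 := ltW (wroot_gt0 j).
rewrite -(@ler_pXn2r _ 1) ?nnegrE ?mulr_ge0 ?wnorm_ge0// ?expr1.
rewrite leNgt; apply/negP => lt.
have := gt0_ltr_powR p0 _ _ lt; rewrite !nnegrE wnorm_ge0 mulr_ge0// => /(_ isT isT).
rewrite wnormE powRM// wrootE ltNge => /negP; apply.
rewrite /wmass (bigD1 j)//= lerDl sumr_ge0// => i _.
by rewrite mulr_ge0 ?powR_ge0// ltW.
Qed.

Lemma ler_wnorm x y : (forall j, 0 <= x j <= y j) -> wnorm x <= wnorm y.
Proof.
move=> xy; apply: ler_powR2 => //; first exact: wmass_ge0.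
by apply: ler_sum => j _; rewrite ler_pM2l// ler_powR2//; have /andP[] := xy j.
Qed.

(* Minkowski's inequality, with the norm of [z - y] replaced by a weighted [l^1] norm. *)
Lemma wnorm_lipschitz y z : (forall j, 0 <= y j <= z j) ->
  wnorm z <= wnorm y + \sum_j wroot j * (z j - y j).
Proof.
move=> yz; have y0 j : 0 <= y j by have /andP[] := yz j.
have z0 j : 0 <= z j by have /andP[yj] := yz j; exact: le_trans.
have x0 j : 0 <= z j - y j by rewrite subr_ge0; have /andP[] := yz j.
have := wroot_le_wnorm (x := z) (j := _); have := wroot_le_wnorm (x := y) (j := _).
have := wnormE z; have := wnormE y; have := wnorm_ge0 y.
move: (wnorm z) (wnorm y) => u v v0 vE uE y_le z_le.
set D := \sum_j _.
have D0 : 0 <= D by apply: sumr_ge0 => j _; rewrite mulr_ge0.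
have [uv|vu] := leP u v; first by rewrite (le_trans uv)// lerDl.
have u0 : 0 < u := le_lt_trans v0 vu.
have ua0 : 0 < u `^ al by exact: powR_gt0.
have uaW := ltW ua0.
(* After multiplication by [u ^ al] the left side is the mass of [z]. One factor [z j] is split as
   [y j + (z j - y j)]: the first sum is bounded by Hölder's inequality, the second
   coordinatewise. *)
rewrite -(ler_pM2l ua0) mulrDr.
have -> : u `^ al * u =
    \sum_j c j * (z j `^ al * y j) + \sum_j c j * (z j `^ al * (z j - y j)).
  rewrite mulrC -powR_1D ?(ltW u0)// uE -big_split; apply: eq_bigr => j _ /=.
  by rewrite powR_1D//; ring.
apply: lerD; last first.
  rewrite /D mulr_sumr; apply: ler_sum => j _.
  have cE : c j = wroot j `^ al * wroot j by rewrite mulrC -powR_1D ?wrootE.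
  have : (wroot j * z j) `^ al <= u `^ al.
    by apply: ler_powR2; [exact: al0W|exact: mulr_ge0|exact: z_le].
  rewrite powRM; [|exact: wroot_ge0|exact: z0] => h.
  have -> : c j * (z j `^ al * (z j - y j)) =
    (wroot j `^ al * z j `^ al) * (wroot j * (z j - y j)) by rewrite cE; ring.
  by apply: ler_wpM2r h; exact: mulr_ge0.
have [v00|v_neq0] := eqVneq v 0.
  rewrite big1; first by rewrite v00 mulr0.
  move=> j _; suff -> : y j = 0 by rewrite !mulr0.
  apply/eqP; rewrite eq_le y0 andbT -(pmulr_rle0 _ (wroot_gt0 j)).
  by rewrite -v00 y_le.
have {v_neq0} v_gt0 : 0 < v by rewrite lt0r v_neq0.
(* Scaling by [r] gives [y] the norm of [z]; summing Young's inequality for [r * y j] and [z j] then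
   yields Hölder's inequality. *)
have [r r0 rv] : exists2 r, 0 < r & r * v = u.
  by exists (u / v); [rewrite divr_gt0|rewrite divfK// gt_eqF].
have rW := ltW r0.
have : (1 + al) * (r * \sum_j c j * (z j `^ al * y j)) <= (1 + al) * u `^ (1 + al).
  rewrite mulr_sumr mulr_sumr.
  apply: (@le_trans _ _ (\sum_j c j * ((r * y j) `^ (1 + al) + al * z j `^ (1 + al)))).
    apply: ler_sum => j _.
    have -> : (1 + al) * (r * (c j * (z j `^ al * y j))) =
        c j * ((1 + al) * (z j `^ al * (r * y j))) by ring.
    by rewrite ler_pM2l; [apply: powR_young; [exact: mulr_ge0|exact: z0]|exact: c0].
  have -> : \sum_j c j * ((r * y j) `^ (1 + al) + al * z j `^ (1 + al)) =
      r `^ (1 + al) * wmass y + al * wmass z.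
    rewrite !mulr_sumr -big_split; apply: eq_bigr => j _ /=.
    by rewrite powRM//; ring.
  rewrite -vE -uE -powRM// rv; lra.
rewrite ler_pM2l// => h.
rewrite -(ler_pM2l r0); apply: (le_trans h).
by rewrite mulrCA rv mulrC powR_1D ?(ltW u0)// mulrC.
Qed.

(* Convexity of the mass and concavity of its root. *)
Lemma wnorm_tangent y z : (forall j, 0 <= y j) -> (forall j, 0 <= z j) ->
  0 < wnorm y ->
  wnorm z <= wnorm y + (wnorm y `^ al)^-1 * \sum_j c j * (z j `^ al * (z j - y j)).
Proof.
move=> y0 z0; have := wnormE z; have := wnormE y.
have := wnorm_ge0 z; move: (wnorm z) (wnorm y) => u v u0 vE uE v0.
have va0 : 0 < v `^ al by exact: powR_gt0.
rewrite -lerBlDl -(ler_pM2l va0) mulrA mulfV ?gt_eqF// mul1r -(ler_pM2l p0).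
apply: (@le_trans _ _ (wmass z - wmass y)).
  have h := powR_young u0 (ltW v0).
  have vD := powR_1D (ltW v0).
  by rewrite -uE -vE; move: h; rewrite vD; lra.
rewrite mulr_sumr -sumrB; apply: ler_sum => j _.
rewrite -mulrBr mulrCA ler_pM2l//.
have h := powR_young (y0 j) (z0 j).
have zD := powR_1D (z0 j).
by move: h; rewrite zD; lra.
Qed.

(** Compares the divisor in [wnorm_tangent] with the sum in which the drift is measured. Each
    [y j ^ al] is bounded by their sum. *)
Lemma wnorm_powR_le y : (forall j, 0 <= y j) ->
  wnorm y `^ al <= (\sum_j c j) `^ (al / (1 + al)) * \sum_j y j `^ al.
Proof.
move=> y0; set S := \sum_j y j `^ al.
have S0 : 0 <= S by apply: sumr_ge0 => *; exact: powR_ge0.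
have C0 : 0 <= \sum_j c j by apply: sumr_ge0 => j _; exact: ltW.
have q0 : 0 <= (1 + al) / al by rewrite divr_ge0.
have mS : wmass y <= (\sum_j c j) * S `^ ((1 + al) / al).
  rewrite mulr_suml; apply: ler_sum => j _; rewrite ler_pM2l//.
  have -> : y j `^ (1 + al) = (y j `^ al) `^ ((1 + al) / al).
    by rewrite -powRrM mulrCA mulfV ?gt_eqF// mulr1.
  apply: ler_powR2 => //; first exact: powR_ge0.
  by rewrite /S (bigD1 j)//= lerDl sumr_ge0// => *; exact: powR_ge0.
have e0 : 0 <= al / (1 + al) by rewrite divr_ge0.
rewrite /wnorm -powRrM mulrC.
apply: le_trans (ler_powR2 e0 (wmass_ge0 y) mS) _.
rewrite powRM ?powR_ge0// -powRrM.
have -> : (1 + al) / al * (al / (1 + al)) = 1 by field; rewrite !gt_eqF.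
by rewrite powRr1.
Qed.

Lemma powR_near1 (e : R) : 0 < e -> exists2 r : R, 0 < r &
  forall t, `|t - 1| <= r -> `|t `^ al - 1| <= e.
Proof.
move=> e0; have : {for 1, continuous (fun t : R => t `^ al)}.
  apply: differentiable_continuous; apply/derivable1_diffP.
  by apply: derivable_powR; rewrite in_itv/= ltr01.
move=> /cvgr_dist_le/(_ _ e0); rewrite powR1 => -[r /= r0 h].
exists (r / 2); first by rewrite divr_gt0.
move=> t tr; rewrite distrC; apply: h => /=; rewrite distrC.
by rewrite (le_lt_trans tr)// ltr_pdivrMr// mulr_natr mulr2n ltrDl.
Qed.

(** For [y > N / r] the shift multiplies [y] by a factor within [r] of 1, hence [y ^ al] by a factor
    within [e / N] of 1. For smaller [y] all terms are bounded and go into [C]. *)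
Lemma powR_shift (N e : R) : 0 < N -> 0 < e -> exists2 C : R, 0 <= C &
  forall y D : R, 0 <= y -> 0 <= y + D -> `|D| <= N ->
  (y + D) `^ al * D <= y `^ al * D + e * y `^ al + C.
Proof.
move=> N0 e0; have [r r0 near1] := powR_near1 (divr_gt0 e0 N0).
exists ((N / r + N) `^ al * N); first by rewrite mulr_ge0 ?powR_ge0// ltW.
move=> y D y0 yD DN.
have ey0 : 0 <= e * y `^ al by rewrite mulr_ge0 ?powR_ge0// ltW.
have [yN|Ny] := leP y (N / r).
  have NN : y + D <= N / r + N by rewrite lerD// (le_trans (ler_norm _)).
  have h1 : (y + D) `^ al <= (N / r + N) `^ al by apply: ler_powR2.
  have h2 : y `^ al <= (N / r + N) `^ al.
    by apply: ler_powR2 => //; rewrite (le_trans yN)// lerDl ltW.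
  have P0 : 0 <= (N / r + N) `^ al by exact: powR_ge0.
  have [D0|D0] := leP 0 D.
    have : (y + D) `^ al * D <= (N / r + N) `^ al * N.
      by apply: ler_pM => //; [exact: powR_ge0|rewrite (le_trans (ler_norm _))].
    have : 0 <= y `^ al * D by rewrite mulr_ge0// powR_ge0.
    lra.
  have : (y + D) `^ al * D <= 0 by rewrite mulr_ge0_le0 ?powR_ge0// ltW.
  have : y `^ al * - D <= (N / r + N) `^ al * N.
    apply: ler_pM => //; [exact: powR_ge0|by rewrite oppr_ge0 ltW|].
    by rewrite (le_trans (ler_norm _))// normrN.
  rewrite mulrN; lra.
have y_gt0 : 0 < y by rewrite (le_lt_trans _ Ny)// divr_ge0// ltW.
have -> : y + D = y * (1 + D / y) by rewrite mulrDr mulr1 mulrCA mulfV ?mulr1 ?gt_eqF.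
have t0 : 0 <= 1 + D / y.
  by rewrite -(pmulr_rge0 _ y_gt0) mulrDr mulr1 mulrCA mulfV ?mulr1 ?gt_eqF.
rewrite powRM//.
have : `|(1 + D / y) `^ al - 1| <= e / N.
  apply: near1; rewrite addrC addKr normrM normfV (gtr0_norm y_gt0).
  rewrite ler_pdivrMr// (le_trans DN)// -ler_pdivrMl// mulrC ltW//.
move=> near.
have : `|((1 + D / y) `^ al - 1) * D| <= e.
  rewrite normrM -[leRHS](@divfK _ N) ?gt_eqF//.
  by apply: ler_pM.
move=> /(le_trans (ler_norm _)) h.
have Y0 : 0 <= y `^ al := powR_ge0 _ _.
have := ler_wpM2l Y0 h.
have : 0 <= (N / r + N) `^ al * N by rewrite mulr_ge0 ?powR_ge0// ltW.
lra.
Qed.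

End power_norm.

(** * Concavity, convex hulls of schedules and optimality of the policy *)

Section policy.
Set Implicit Arguments.
Unset Strict Implicit.
Context {R : realType}.

Lemma strictly_concave_slope (f : R -> R) x y z : strictly_concave_Rplus f ->
  0 <= x -> x < y -> y < z ->
  (f z - f y) / (z - y) <= (f y - f x) / (y - x).
Proof.
move=> fc x0 xy yz; have zx : 0 < z - x by rewrite subr_gt0 (lt_trans xy).
have zy : 0 < z - y by rewrite subr_gt0.
have yx : 0 < y - x by rewrite subr_gt0.
have t01 : 0 < (z - y) / (z - x) < 1.
  by rewrite divr_gt0//= ltr_pdivrMr// mul1r ltrD2l ltrN2.
have z0 : 0 <= z by rewrite (le_trans x0)// ltW// (lt_trans xy).
have xz : x != z by rewrite lt_eqF// (lt_trans xy).
have := fc x z _ x0 z0 xz t01.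
have -> : (z - y) / (z - x) * x + (1 - (z - y) / (z - x)) * z = y.
  by field; rewrite gt_eqF.
have -> : (z - y) / (z - x) * f x + (1 - (z - y) / (z - x)) * f z =
    ((z - y) * f x + (y - x) * f z) / (z - x).
  by field; rewrite gt_eqF.
rewrite ltr_pdivrMr// => h.
rewrite ler_pdivrMr// mulrAC ler_pdivlMr//; lra.
Qed.

(** The supremum of the slopes to the right of [x0] lies below all slopes to the left. It is
    positive because [f] increases. *)
Lemma supergradient (f : R -> R) x0 : strictly_increasing_Rplus f ->
  strictly_concave_Rplus f -> 0 < x0 ->
  exists2 c, 0 < c & forall x, 0 <= x -> f x <= f x0 + c * (x - x0).
Proof.
move=> fi fc x00; have x00W := ltW x00.
pose A : set R := [set (f y - f x0) / (y - x0) | y in [set y | x0 < y]].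
have ubA x : 0 <= x -> x < x0 -> ubound A ((f x0 - f x) / (x0 - x)).
  by move=> x_ge0 xx0 _ [y x0y <-]; exact: strictly_concave_slope.
have hsA : has_sup A.
  split; first by exists ((f (x0 + 1) - f x0) / (x0 + 1 - x0)), (x0 + 1) => //=;
    rewrite ltrDl.
  by eexists; exact: (ubA 0).
have Asup y : x0 < y -> (f y - f x0) / (y - x0) <= sup A.
  by move=> x0y; apply: ub_le_sup; [case: hsA|exists y].
exists (sup A).
  have x01 : x0 < x0 + 1 by rewrite ltrDl.
  apply: lt_le_trans (Asup _ x01); rewrite divr_gt0 ?subr_gt0//.
  exact: fi.
move=> x x_ge0; rewrite -lerBlDl.
have [xx0|x0x|->] := ltgtP x x0; last by rewrite !subrr mulr0.
  have : sup A <= (f x0 - f x) / (x0 - x).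
    by apply: ge_sup; [case: hsA|exact: ubA].
  by rewrite ler_pdivlMr ?subr_gt0//; lra.
by have := Asup _ x0x; rewrite ler_pdivrMr ?subr_gt0.
Qed.

Context {J : finType}.
Implicit Types (q s p : state J) (x : J -> R) (S : {fset state J}).

Lemma hull_interior_scale S (x : {ptws J -> R}) : (hull S)° x ->
  exists2 e, 0 < e & hull S (fun j => (1 + e) * x j).
Proof.
move=> Sx.
have : {ptws, (fun e : R => (fun j => (1 + e) * x j)) @ 0^'+ --> x}.
  apply/cvg_sup => j A /= [_ [[B oB <-] /= Bx BA]].
  apply: filterS BA _ => /=.
  have : (1 + e) * x j @[e --> 0^'+] --> (1 + 0) * x j.
    apply: cvgM; last exact: cvg_cst.
    apply: cvgD; first exact: cvg_cst.
    by apply: cvg_at_right_filter; exact: cvg_id.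
  rewrite addr0 mul1r => /(_ B); apply.
  exact: open_nbhs_nbhs.
move=> /(_ _ Sx) h.
have : \forall e \near 0^'+, hull S (fun j => (1 + e) * x j) /\ 0 < e.
  by near=> e; split; near: e => //; exact: nbhs_right_gt.
by move=> /filter_ex[e [? ?]]; exists e.
Unshelve. all: by end_near. Qed.

Lemma hull_ge0 S x j : hull S x -> 0 <= x j.
Proof.
move=> [w [w0 _ ->]]; rewrite big_seq; apply: sumr_ge0 => p pS.
by rewrite mulr_ge0// w0.
Qed.

(* Truncate every schedule of the convex combination at [q]. *)
Lemma hull_cap S q (x : {ptws J -> R}) (M : nat) :
  (forall p j, p \in S -> (p j <= M)%N) -> hull S x ->
  exists2 y : {ptws J -> R}, hull (cap S q) y &
    forall j, 0 <= y j <= x j /\ ((M <= q j)%N -> y j = x j).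
Proof.
move=> pM [w [w0 w1 xE]].
pose y : {ptws J -> R} := fun j => \sum_(p <- S) w p * (meet p q j)%:R.
exists y.
  (* Different schedules may have the same truncation, so weights are added up over the fibres. *)
  exists (fun r => \sum_(p <- S | meet p q == r) w p); split.
  - move=> r _; rewrite big_seq_cond; apply: sumr_ge0 => p /andP[pS _]; exact: w0.
  - by rewrite -[RHS]w1 [RHS](partition_big_imfset _ (fun p => meet p q)).
  - move=> j; rewrite /y (partition_big_imfset _ (fun p => meet p q)).
    apply: eq_bigr => r _; rewrite mulr_suml; apply: eq_bigr => p /eqP <-.
    by [].
move=> j; split; last first.
  move=> Mq; rewrite xE /y big_seq [RHS]big_seq; apply: eq_bigr => p pS.
  by rewrite ffunE (minn_idPl _)// (leq_trans (pM _ j pS)).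
rewrite xE /y; apply/andP; split.
  by rewrite big_seq; apply: sumr_ge0 => p pS; rewrite mulr_ge0// w0.
rewrite big_seq [leRHS]big_seq; apply: ler_sum => p pS; rewrite ler_wpM2l ?w0//.
by rewrite ler_nat ffunE geq_minl.
Qed.

(** The supergradient bounds [c j * (x j - s j)] by [g j (x j) - g j (s j)]. Replacing [x j] by the
    larger [zx j] gains [gap j], the source of the negative term. Optimality compares [s] with the
    truncation [y] of [zx], which differs from [zx j] only where [q j < M], at bounded cost. *)
Lemma policy_drift (al : R) (g : J -> R -> R) S (x : {ptws J -> R}) :
  0 < al -> (forall j, 0 < x j) ->
  (forall j, strictly_increasing_Rplus (g j)) ->
  (forall j, strictly_concave_Rplus (g j)) ->
  (hull S)° x ->
  exists c : J -> R, (forall j, 0 < c j) /\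
  exists C e : R, [/\ 0 <= C, 0 < e & forall q (s : {ptws J -> R}),
    optimal al g S q s ->
    \sum_j c j * (q j)%:R `^ al * (x j - s j) <= C - e * \sum_j (q j)%:R `^ al].
Proof.
move=> al0 x0 gi gc Sx.
have [z z0 Sz] := hull_interior_scale Sx.
have /choice[c cP] j : exists c, 0 < c /\
    forall y, 0 <= y -> g j y <= g j (x j) + c * (y - x j).
  by have [c c0 h] := supergradient (gi j) (gc j) (x0 j); exists c.
pose zx j := (1 + z) * x j.
have xzx j : x j < zx j by rewrite /zx mulrDl mul1r ltrDl mulr_gt0.
have zx0 j : 0 <= zx j by rewrite ltW// (lt_trans (x0 j)).
pose gap j := g j (zx j) - g j (x j).
have gap0 j : 0 < gap j by rewrite subr_gt0 gi// ltW.
exists c; split; first by move=> j; have [] := cP j.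
pose M := (\sum_(p <- S) \sum_j p j)%N.
have pM p j : p \in S -> (p j <= M)%N.
  by move=> pS; rewrite /M (big_fsetD1 p)//= (bigD1 j)//= -addnA leq_addr.
pose range j := g j (zx j) - g j 0.
have range0 j : 0 <= range j.
  rewrite subr_ge0; have := zx0 j; rewrite le_eqVlt => /predU1P[<-//|].
  by move=> /gi h; rewrite ltW// h.
(* The second constant is below every [gap j]; the summand 1 keeps it positive when [J] is empty. *)
exists (\sum_j M%:R `^ al * range j), (1 + \sum_j (gap j)^-1)^-1; split.
- by apply: sumr_ge0 => j _; rewrite mulr_ge0 ?powR_ge0.
- by rewrite invr_gt0 ltr_pwDl// sumr_ge0// => j _; rewrite invr_ge0 ltW.
set e := (1 + _)^-1.
have e_gap j : e <= gap j.
  rewrite -[leRHS]invrK lef_pV2 ?posrE ?invr_gt0//; last first.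
    by rewrite ltr_pwDl// sumr_ge0// => i _; rewrite invr_ge0 ltW.
  rewrite (bigD1 j)//= addrCA lerDl addr_ge0//.
  by apply: sumr_ge0 => i _; rewrite invr_ge0 ltW.
move=> q s [sS sopt].
have [y yS yP] := hull_cap q pM Sz.
have := sopt _ yS; rewrite /objective => opt.
rewrite mulr_sumr -sumrB.
suff : \sum_j c j * (q j)%:R `^ al * (x j - s j) <=
    \sum_j (M%:R `^ al * range j - e * (q j)%:R `^ al) +
    (\sum_j g j (y j) * (q j)%:R `^ al - \sum_j g j (s j) * (q j)%:R `^ al).
  by move: opt; lra.
rewrite -sumrB -big_split; apply: ler_sum => j _ /=.
have Q0 : 0 <= (q j)%:R `^ al := powR_ge0 _ _.
have [c0 cS] := cP j.
have sg : c j * (x j - s j) <= g j (x j) - g j (s j).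
  by have := cS _ (hull_ge0 j sS); lra.
have gy : (g j (zx j) - g j (y j)) * (q j)%:R `^ al <= M%:R `^ al * range j.
  have [/andP[y0 yz] yE] := yP j.
  have [Mq|qM] := leqP M (q j).
    by rewrite yE// subrr mul0r mulr_ge0 ?powR_ge0.
  rewrite mulrC; apply: ler_pM => //.
  - rewrite subr_ge0; move: yz; rewrite le_eqVlt => /predU1P[->//|].
    by move=> /(gi j _ _ y0)/ltW.
  - by apply: ler_powR2; rewrite ?(ltW al0)// ler_nat ltnW.
  - rewrite lerD2l lerN2; move: y0; rewrite le_eqVlt => /predU1P[<-//|].
    by move=> /(gi j _ _ (lexx _))/ltW.
have := ler_wpM2r Q0 sg.
have := ler_wpM2r Q0 (e_gap j).
rewrite /gap; lra.
Qed.

End policy.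

(** * Drift *)

Section drift.
Set Implicit Arguments.
Unset Strict Implicit.
Context {R : realType} {J : finType}.
Variables (al : R) (c : J -> R).
Hypotheses (al0 : 0 < al) (c0 : forall j, 0 < c j).
Implicit Types q s b : state J.

Definition lyapunov q : R := wnorm al c (fun j => (q j)%:R).

Definition serve q s b : state J := [ffun j => (q j - s j + b j)%N].

Let V q := (lyapunov q `^ al)^-1.

Let dist_le (m s M B : R) : 0 <= m -> m <= B -> 0 <= s -> s <= M -> `|m - s| <= M + B.
Proof. by move=> *; rewrite ler_norml; apply/andP; split; lra. Qed.

Let combine (L N v Sk Sb T1 X Y : R) :
  L <= N + T1 -> N <= v + X -> X <= Sb - Sk + Y -> L + Sk <= v + Y + (Sb + T1).
Proof. by move=> *; lra. Qed.

Let scaled_le (Q f D b e C : R) : 0 <= Q -> D <= b -> f <= Q * D + e * Q + C ->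
  f <= Q * b + e * Q + C.
Proof. by move=> Q0 Db h; have := ler_wpM2l Q0 Db; lra. Qed.

Lemma lyapunov_ge0 q : 0 <= lyapunov q. Proof. exact: wnorm_ge0. Qed.

Lemma lyapunov_serve_le q s b :
  lyapunov (serve q s b) <= lyapunov q + \sum_j wroot al c j * (b j)%:R.
Proof.
have h : forall j, 0 <= ((q j - s j)%N%:R : R) <= (serve q s b j)%:R.
  by move=> j; rewrite ler0n ler_nat ffunE leq_addr.
apply: le_trans (wnorm_lipschitz al0 c0 h) _; apply: lerD.
  by apply: ler_wnorm => // j; rewrite ler0n ler_nat leq_subr.
by apply: ler_sum => j _; rewrite ffunE natrD addrAC subrr add0r.
Qed.

(** The service term stands on the left so that, for nonnegative [C] and [e] and positive [B], both
    sides are sums of nonnegative terms, ready for integration in the extended reals. *)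
Definition serve_bound (M : nat) (B e C : R) q := forall s b,
  (forall j, (s j <= q j)%N) -> (forall j, (s j <= M)%N) ->
  lyapunov (serve q s b) + \sum_j V q * (c j * (q j)%:R `^ al) * (s j)%:R <=
  lyapunov q + V q * (e * (\sum_j c j * (q j)%:R `^ al) + C) +
  (\sum_j V q * (c j * (q j)%:R `^ al) * (b j)%:R +
   \sum_j wroot al c j / B * (b j)%:R ^+ 2).

(** Arrivals in excess of [B] are at most [b ^ 2 / B] and are paid for by the Lipschitz bound. The
    truncated increment stays within [M + B], so [powR_shift] provides a [C] independent of [q]. *)
Lemma lyapunov_serve (M : nat) (B e : R) : 0 < B -> 0 < e ->
  exists2 C : R, 0 <= C & forall q, 0 < lyapunov q -> serve_bound M B e C q.
Proof.
move=> B0 e0; have N0 : 0 < M%:R + B by rewrite ltr_wpDl.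
have [C C0 CP] := powR_shift al0 N0 e0.
have c0W j : 0 <= c j by exact: ltW.
exists (C * \sum_j c j); first by rewrite mulr_ge0// sumr_ge0.
move=> q v0 s b sq sM.
(* The step with arrivals truncated at [B]. *)
pose D j : R := Num.min (b j)%:R B - (s j)%:R.
pose z j : R := (q j)%:R + D j.
have zE j : z j = (q j - s j)%:R + Num.min (b j)%:R B.
  by rewrite /z /D natrB//; lra.
have m0 j : 0 <= Num.min (b j)%:R B by rewrite le_min ler0n ltW.
have z0 j : 0 <= z j by rewrite zE addr_ge0.
have bB j : (b j)%:R - Num.min (b j)%:R B <= (b j)%:R ^+ 2 / B.
  have b0 : 0 <= (b j)%:R :> R by [].
  rewrite ler_pdivlMr//; case: (leP (b j)%:R B) => h.
    by rewrite subrr mul0r exprn_ge0.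
  by rewrite mulrBl expr2; nra.
have step1 : lyapunov (serve q s b) <= wnorm al c z + \sum_j wroot al c j / B * (b j)%:R ^+ 2.
  have h : forall j, 0 <= z j <= (serve q s b j)%:R.
    by move=> j; rewrite z0 zE ffunE natrD lerD2l ge_min lexx.
  apply: le_trans (wnorm_lipschitz al0 c0 h) _; rewrite lerD2l.
  apply: ler_sum => j _; rewrite -mulrA ler_pM2l; last exact: wroot_gt0.
  by have := bB j; rewrite zE ffunE natrD (mulrC B^-1); lra.
have V0 : 0 <= V q by rewrite invr_ge0 powR_ge0.
have step2 : wnorm al c z <= lyapunov q + V q * \sum_j c j * (z j `^ al * D j).
  have q0 : forall j, 0 <= (q j)%:R :> R by [].
  have := wnorm_tangent al0 c0 q0 z0 v0; congr (_ <= _ + _ * _).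
  by apply: eq_bigr => j _; rewrite {2}/z addrAC subrr add0r.
(* Once the coefficient is the power of [q j], the truncated arrivals may be enlarged to the full
   ones, whose mean is known. *)
have step3 : \sum_j c j * (z j `^ al * D j) <=
    \sum_j c j * ((q j)%:R `^ al * ((b j)%:R - (s j)%:R) + e * (q j)%:R `^ al + C).
  apply: ler_sum => j _; rewrite ler_pM2l//.
  have DN : `|D j| <= M%:R + B.
    have sM' : (s j)%:R <= M%:R :> R by rewrite ler_nat.
    have s0 : 0 <= (s j)%:R :> R by [].
    have mB : Num.min (b j)%:R B <= B by rewrite ge_min lexx orbT.
    exact: dist_le.
  apply: scaled_le (CP (q j)%:R (D j) (ler0n _ _) (z0 j) DN); first exact: powR_ge0.
  by rewrite lerD2r ge_min lexx.
have := ler_wpM2l V0 step3.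
have -> : V q * \sum_j c j * ((q j)%:R `^ al * ((b j)%:R - (s j)%:R) + e * (q j)%:R `^ al + C) =
    \sum_j V q * (c j * (q j)%:R `^ al) * (b j)%:R -
    \sum_j V q * (c j * (q j)%:R `^ al) * (s j)%:R +
    V q * (e * (\sum_j c j * (q j)%:R `^ al) + C * \sum_j c j).
  rewrite !mulr_sumr -sumrB -!big_split/= mulr_sumr -big_split/=.
  by apply: eq_bigr => j _; ring.
exact: combine step1 step2.
Qed.

Lemma finite_lyapunov_level (r : R) : finite_set [set q | lyapunov q <= r].
Proof.
(* On the level set [q j <= r / wroot j]; the sum is a bound common to all coordinates. *)
pose N := (Num.trunc (\sum_j r / wroot al c j)).+1.
have [r0|r0] := ltP r 0.
  rewrite (_ : [set _ | _] = set0)//; apply/seteqP; split=> // q /= qr.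
  by have := le_lt_trans qr r0; rewrite ltNge lyapunov_ge0.
pose f (h : {ffun J -> 'I_N}) : state J := [ffun j => nat_of_ord (h j)].
apply: (@sub_finite_set _ _ (f @` setT)); last exact: finite_image finite_finset.
move=> q /= qr.
have qN j : (q j < N)%N.
  rewrite -(ltr_nat R); apply: le_lt_trans (truncnS_gt _).
  have d0 := wroot_gt0 al c0; rewrite (bigD1 j)//= -[leLHS]addr0; apply: lerD.
    by rewrite ler_pdivlMr// mulrC (le_trans _ qr)// wroot_le_wnorm.
  by apply: sumr_ge0 => i _; rewrite divr_ge0// ltW.
exists [ffun j => Ordinal (qN j)] => //.
by apply/ffunP => j; rewrite !ffunE.
Qed.

End drift.

(** * Expectation of the one-step inequality *)

Section expectations.
Set Implicit Arguments.
Unset Strict Implicit.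
Context {R : realType} {J : finType} {d : measure_display} {T : measurableType d}.
Variable P : probability T R.

Lemma integral_linear (X : J -> T -> R) (k : J -> R) :
  (forall j, measurable_fun setT (X j)) -> (forall j w, 0 <= X j w) ->
  (forall j, 0 <= k j) ->
  (\int[P]_w (\sum_j k j * X j w)%:E = \sum_j (k j)%:E * \int[P]_w (X j w)%:E)%E.
Proof.
move=> mX X0 k0.
under eq_integral do rewrite -sumEFin.
rewrite ge0_integral_sum//.
- apply: eq_bigr => j _; under eq_integral do rewrite EFinM.
  by rewrite ge0_integralZl//; [exact/measurable_EFinP|move=> w _; rewrite lee_fin|rewrite lee_fin].
- by move=> j; apply/measurable_EFinP; apply: measurable_funM.
- by move=> j w _; rewrite lee_fin mulr_ge0.
Qed.

Let integral_prob_cst (r : R) : (\int[P]_w r%:E = r%:E)%E.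
Proof.
by apply: etrans (integral_cst P measurableT r%:E) _; rewrite /= probability_setT mule1.
Qed.

(** The almost sure inequality is integrated in the extended reals; as the mean of [L] is finite,
    the service term can then be moved across. *)
Lemma integral_affine_le (L : T -> R) (s b b2 : J -> T -> R) (k h sm bm : J -> R) (C K : R) :
  measurable_fun setT L -> (forall j, measurable_fun setT (s j)) ->
  (forall j, measurable_fun setT (b j)) -> (forall j, measurable_fun setT (b2 j)) ->
  (forall w, 0 <= L w) -> (forall j w, 0 <= s j w) ->
  (forall j w, 0 <= b j w) -> (forall j w, 0 <= b2 j w) ->
  (forall j, 0 <= k j) -> (forall j, 0 <= h j) -> 0 <= C ->
  (forall j, \int[P]_w (s j w)%:E = (sm j)%:E)%E ->
  (forall j, \int[P]_w (b j w)%:E = (bm j)%:E)%E ->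
  (forall j, \int[P]_w (b2 j w)%:E <= K%:E)%E ->
  (\int[P]_w (L w)%:E < +oo)%E ->
  {ae P, forall w, L w + \sum_j k j * s j w <=
    C + (\sum_j k j * b j w + \sum_j h j * b2 j w)} ->
  (\int[P]_w (L w)%:E <= (C + \sum_j k j * (bm j - sm j) + \sum_j h j * K)%:E)%E.
Proof.
move=> mL ms mb mb2 L0 s0 b0 b20 k0 h0 C0 sE bE b2K Lfin ae_le.
have mlin (X : J -> T -> R) (f : J -> R) : (forall j, measurable_fun setT (X j)) ->
    measurable_fun setT (fun w => (\sum_j f j * X j w)%:E).
  move=> mX; apply/measurable_EFinP; apply: measurable_sum => j.
  exact: measurable_funM.
have lin0 (X : J -> T -> R) (f : J -> R) w : (forall j w, 0 <= X j w) ->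
    (forall j, 0 <= f j) -> (0 <= (\sum_j f j * X j w)%:E)%E.
  by move=> X0 f0; rewrite lee_fin; apply: sumr_ge0 => j _; rewrite mulr_ge0.
have mLE : measurable_fun setT (EFin \o L) by exact/measurable_EFinP.
have L0E w : (0 <= (L w)%:E)%E by rewrite lee_fin.
have C0E : (0 <= C%:E)%E by rewrite lee_fin.
have key : (\int[P]_w ((L w)%:E + (\sum_j k j * s j w)%:E) <=
    \int[P]_w (C%:E + ((\sum_j k j * b j w)%:E + (\sum_j h j * b2 j w)%:E)))%E.
  apply: ae_ge0_le_integral.
  - exact: measurableT.
  - by move=> w _; apply: adde_ge0 => //; exact: lin0.
  - by apply: emeasurable_funD => //; exact: mlin.
  - move=> w _; apply: adde_ge0 => //; apply: adde_ge0; exact: lin0.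
  - apply: emeasurable_funD => //; apply: emeasurable_funD; exact: mlin.
  - by apply: filterS ae_le => w h' _; rewrite -!EFinD lee_fin.
have int1 (X : J -> T -> R) (m : J -> R) : (forall j, measurable_fun setT (X j)) ->
    (forall j w, 0 <= X j w) -> (forall j, \int[P]_w (X j w)%:E = (m j)%:E)%E ->
    (\int[P]_w (\sum_j k j * X j w)%:E = (\sum_j k j * m j)%:E)%E.
  move=> mX X0 mE; rewrite integral_linear//.
  by rewrite -sumEFin; apply: eq_bigr => j _; rewrite mE EFinM.
have int2 : (\int[P]_w (\sum_j h j * b2 j w)%:E <= (\sum_j h j * K)%:E)%E.
  rewrite integral_linear// -sumEFin; apply: lee_sum => j _; rewrite EFinM.
  by apply: lee_wpmul2l; rewrite ?lee_fin.
have lhsE : (\int[P]_w ((L w)%:E + (\sum_j k j * s j w)%:E) =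
    \int[P]_w (L w)%:E + (\sum_j k j * sm j)%:E)%E.
  rewrite ge0_integralD;
    [by rewrite (int1 _ _ ms s0 sE)|exact: measurableT|by []|by []| |exact: mlin].
  by move=> w _; exact: lin0.
have rhs_le : (\int[P]_w (C%:E + ((\sum_j k j * b j w)%:E + (\sum_j h j * b2 j w)%:E)) <=
    (C + (\sum_j k j * bm j + \sum_j h j * K))%:E)%E.
  rewrite ge0_integralD; [|exact: measurableT|by []|by []| |].
  - apply: (@le_trans _ _ (C%:E + ((\sum_j k j * bm j)%:E + (\sum_j h j * K)%:E))%E).
      rewrite integral_prob_cst leeD2l// ge0_integralD.
      + by rewrite (int1 _ _ mb b0 bE) leeD2l.
      + exact: measurableT.
      + by move=> w _; exact: lin0.
      + exact: mlin.
      + by move=> w _; exact: lin0.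
      + exact: mlin.
    by rewrite -!EFinD.
  - by move=> w _; apply: adde_ge0; exact: lin0.
  - by apply: emeasurable_funD; exact: mlin.
move: key; rewrite lhsE => /le_trans/(_ rhs_le).
have EV0 : (0 <= \int[P]_w (L w)%:E)%E by exact: integral_ge0.
move: Lfin; rewrite -(ge0_fin_numE EV0) => /fineK <-.
rewrite -EFinD !lee_fin -lerBrDr => /le_trans; apply.
have -> : \sum_j k j * (bm j - sm j) = \sum_j k j * bm j - \sum_j k j * sm j.
  by rewrite -sumrB; apply: eq_bigr => j _; ring.
lra.
Qed.

Lemma measurable_discrete (X : T -> state J) (F : state J -> R) :
  measurable_fun setT X -> measurable_fun setT (fun w => F (X w)).
Proof. by move=> mX; apply: measurableT_comp => // ? B _. Qed.

Variables (al : R) (c : J -> R).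
Hypotheses (al0 : 0 < al) (c0 : forall j, 0 < c j).
Variables (sched arr : T -> state J).
Hypotheses (msched : measurable_fun setT sched) (marr : measurable_fun setT arr).
Variables (abar sbar : J -> R) (K : R).
Hypothesis sched_mean : forall j, (\int[P]_w (sched w j)%:R%:E = (sbar j)%:E)%E.
Hypothesis arr_mean : forall j, (\int[P]_w (arr w j)%:R%:E = (abar j)%:E)%E.
Hypothesis arr_var : forall j, (\int[P]_w ((arr w j)%:R ^+ 2)%:E <= K%:E)%E.

Let mcoord (X : T -> state J) j (n : nat) :
  measurable_fun setT X -> measurable_fun setT (fun w => (X w j)%:R ^+ n : R).
Proof. exact: (@measurable_discrete X (fun s => (s j)%:R ^+ n)). Qed.

Lemma measurable_lyapunov_serve (q : state J) :
  measurable_fun setT (fun w => lyapunov al c (serve q (sched w) (arr w))).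
Proof.
have mserve : measurable_fun setT (fun w => serve q (sched w) (arr w)).
  move=> _ Z _; rewrite setTI.
  rewrite (_ : _ @^-1` _ = \bigcup_(s : state J)
    ((sched @^-1` [set s]) `&` (arr @^-1` [set b | Z (serve q s b)]))).
    apply: countable_bigcupT_measurable => [|s]; first exact: countableP.
    by apply: measurableI; rewrite -[X in measurable X]setTI; [exact: msched|exact: marr].
  by apply/seteqP; split=> [w Zw|w [s _ [/= -> //]]]; exists (sched w).
exact: measurable_discrete mserve.
Qed.

Lemma lyapunov_mean_fin q : (\int[P]_w (lyapunov al c (serve q (sched w) (arr w)))%:E < +oo)%E.
Proof.
apply: (@le_lt_trans _ _ (\int[P]_w ((lyapunov al c q)%:E +
    (\sum_j wroot al c j * (arr w j)%:R)%:E))%E).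
  apply: ge0_le_integral => //.
  - by move=> w _; rewrite lee_fin lyapunov_ge0.
  - by apply/measurable_EFinP; exact: measurable_lyapunov_serve.
  - apply/measurable_EFinP; apply: measurable_funD => //.
    apply: measurable_sum => j; apply: measurable_funM => //.
    exact: (mcoord j 1 marr).
  - by move=> w _; rewrite lee_fin lyapunov_serve_le.
rewrite ge0_integralD//; last 3 first.
- by move=> w _; rewrite lee_fin lyapunov_ge0.
- by move=> w _; rewrite lee_fin sumr_ge0// => j _; rewrite mulr_ge0// ltW// wroot_gt0.
- apply/measurable_EFinP; apply: measurable_sum => j; apply: measurable_funM => //.
  exact: (mcoord j 1 marr).
rewrite integral_prob_cst integral_linear//; last 2 first.
- by move=> j; exact: (mcoord j 1 marr).
- by move=> j; rewrite ltW// wroot_gt0.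
under eq_bigr do rewrite arr_mean -EFinM.
by rewrite sumEFin -EFinD ltry.
Qed.

Lemma lyapunov_mean_serve (M : nat) (B e C : R) q :
  0 < B -> 0 < e -> 0 <= C -> 0 < lyapunov al c q -> serve_bound al c M B e C q ->
  {ae P, forall w, forall j, (sched w j <= q j)%N /\ (sched w j <= M)%N} ->
  (\int[P]_w (lyapunov al c (serve q (sched w) (arr w)))%:E <=
    (lyapunov al c q + (lyapunov al c q `^ al)^-1 *
       (\sum_j c j * (q j)%:R `^ al * (abar j - sbar j) +
         (e * (\sum_j c j * (q j)%:R `^ al) + C)) +
     \sum_j wroot al c j / B * K)%:E)%E.
Proof.
move=> B0 e0 C0 v0 CPq ae_s.
move: (lyapunov_mean_fin q) (measurable_lyapunov_serve q) => mean_fin mL.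
pose k j := (lyapunov al c q `^ al)^-1 * (c j * (q j)%:R `^ al).
have c0W j : 0 <= c j by exact: ltW.
have Vq0 : 0 <= (lyapunov al c q `^ al)^-1 by rewrite invr_ge0 powR_ge0.
have k0 j : 0 <= k j by rewrite !mulr_ge0// powR_ge0.
have h0 j : 0 <= wroot al c j / B by rewrite divr_ge0 ?(ltW B0)// ltW// wroot_gt0.
have C10 : 0 <= lyapunov al c q +
    (lyapunov al c q `^ al)^-1 * (e * (\sum_j c j * (q j)%:R `^ al) + C).
  rewrite addr_ge0 ?(ltW v0)// mulr_ge0// addr_ge0// mulr_ge0 ?(ltW e0)//.
  by apply: sumr_ge0 => j _; rewrite mulr_ge0 ?powR_ge0.
have ms j : measurable_fun setT (fun w => (sched w j)%:R : R).
  exact: (measurable_discrete (fun s => (s j)%:R) msched).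
have mb j : measurable_fun setT (fun w => (arr w j)%:R : R).
  exact: (measurable_discrete (fun s => (s j)%:R) marr).
have mb2 j : measurable_fun setT (fun w => (arr w j)%:R ^+ 2 : R) by exact: mcoord.
have b20 j w : 0 <= (arr w j)%:R ^+ 2 :> R by exact: exprn_ge0.
have L0 w : 0 <= lyapunov al c (serve q (sched w) (arr w)) by exact: lyapunov_ge0.
have := integral_affine_le mL ms mb mb2 L0 (fun j w => ler0n _ _) (fun j w => ler0n _ _)
  b20 k0 h0 C10 sched_mean arr_mean arr_var mean_fin.
move=> /(_ _)/wrap[].
  apply: filterS ae_s => w sw.
  by apply: CPq => j; have [] := sw j.
move=> h; apply: (le_trans h); rewrite lee_fin.
have -> : \sum_j k j * (abar j - sbar j) =
    (lyapunov al c q `^ al)^-1 * \sum_j c j * (q j)%:R `^ al * (abar j - sbar j).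
  by rewrite mulr_sumr; apply: eq_bigr => j _; rewrite /k !mulrA.
by rewrite [in leRHS]mulrDr [in leRHS](addrC (_^-1 * _)) addrA.
Qed.

End expectations.

(** * Balancing the constants of the drift *)

Section real_bounds.
Set Implicit Arguments.
Unset Strict Implicit.
Context {R : realType}.

(** The term [- e * S / va] is at most [- e / k]. Moving the gradient uses up half of it, the
    constants [C1 + C] cost at most [e / (8 * k)] once [va] is large, and so does the truncation
    [L]; what remains is [e / (4 * k)]. *)
Lemma negative_drift (EV v va S X Y c C1 C e k L : R) :
  0 < va -> 0 < k -> 0 < e -> 0 <= S -> 0 <= c ->
  va <= k * S -> X <= C1 - e * S -> Y <= c * S ->
  (C1 + C) * (8 * k / e) <= va -> L <= e / (8 * k) ->
  EV <= v + va^-1 * (X + (e / (2 * (1 + c)) * Y + C)) + L ->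
  EV <= v - e / (4 * k).
Proof.
move=> va0 k0 e0 S0 c0 vaS XS YS Cva Lk EVle.
have c1 : 0 < 2 * (1 + c) by lra.
have YS2 : e / (2 * (1 + c)) * Y <= e / 2 * S.
  apply: (@le_trans _ _ (e / (2 * (1 + c)) * (c * S))).
    by rewrite ler_wpM2l// divr_ge0// ltW.
  rewrite mulrA ler_wpM2r// mulrAC ler_pdivrMr//.
  by rewrite mulrAC ler_pdivlMr//; nra.
have h1 : va^-1 * (X + (e / (2 * (1 + c)) * Y + C)) <=
    va^-1 * (C1 + C) - va^-1 * (e / 2 * S).
  by rewrite -mulrBr ler_wpM2l ?invr_ge0 ?(ltW va0)//; lra.
have h2 : va^-1 * (C1 + C) <= e / (8 * k).
  rewrite mulrC ler_pdivrMr// -(@ler_pM2r _ (8 * k / e)).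
    have -> : e / (8 * k) * va * (8 * k / e) = va by field; rewrite !gt_eqF.
    exact: Cva.
  by rewrite divr_gt0 ?mulr_gt0.
have h3 : e / (2 * k) <= va^-1 * (e / 2 * S).
  rewrite [leRHS]mulrC ler_pdivlMr// mulrAC ler_pdivrMr ?mulr_gt0//.
  by have := ler_wpM2l (ltW e0) vaS; lra.
have -> : e / (4 * k) = e / (2 * k) - e / (8 * k) - e / (8 * k).
  by field; rewrite gt_eqF.
lra.
Qed.

Lemma exists_scale (J : finType) (f : J -> R) (K e : R) : 0 < e ->
  exists2 B, 0 < B & \sum_j f j / B * K <= e.
Proof.
move=> e0; set D := \sum_j f j * K.
have B0 : 0 < 1 + `|D| / e by rewrite ltr_wpDr// divr_ge0// ltW.
exists (1 + `|D| / e) => //.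
have -> : \sum_j f j / (1 + `|D| / e) * K = D / (1 + `|D| / e).
  by rewrite mulr_suml; apply: eq_bigr => j _; rewrite mulrAC.
rewrite ler_pdivrMr// mulrDr mulr1 mulrCA mulfV ?gt_eqF// mulr1.
by rewrite (le_trans (ler_norm D))// lerDr ltW.
Qed.

Lemma le_powR_root (al t v : R) : 0 < al -> 0 <= t -> t `^ al^-1 <= v -> t <= v `^ al.
Proof.
move=> al0 t0 tv; have -> : t = (t `^ al^-1) `^ al.
  by rewrite -powRrM mulVf ?gt_eqF// powRr1.
by apply: ler_powR2; [exact: ltW|exact: powR_ge0|].
Qed.

End real_bounds.

(** * The law of the random schedule *)

Section maxweight_schedule.
Set Implicit Arguments.
Unset Strict Implicit.
Context (R : realType) (J : finType) (d : measure_display) (T : measurableType d).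
Context (P : probability T R) (U : {RV P >-> R}).
Hypothesis U_law : forall A : set R, measurable A ->
  distribution P U A = uniform_prob (@ltr01 R) A.
Context (phi : R -> state J).
Hypothesis mphi : measurable_fun setT phi.

Lemma integral_schedule (f : state J -> R) : (forall s, 0 <= f s) ->
  (\int[P]_w (f (phi (U w)))%:E = \int[uniform_prob (@ltr01 R)]_u (f (phi u))%:E)%E.
Proof.
move=> f0.
have mf : measurable_fun setT (fun u => (f (phi u))%:E).
  by apply/measurable_EFinP; exact: measurable_discrete.
rewrite -(@ge0_integral_distribution _ _ _ _ _ P U (fun u => (f (phi u))%:E))//; last first.
  by move=> u; rewrite lee_fin.
have fE0 s : (0 <= (f s)%:E)%E by rewrite lee_fin.
have /countable_injP[code codeI'] : countable [set: state J] by exact: countableP.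
have codeI : injective code by move=> s t; apply: codeI'; rewrite inE.
rewrite (discrete_integral (V := state J) _ (distribution P U) codeI measurableT mphi fE0)//.
rewrite (discrete_integral (V := state J) _ (uniform_prob (@ltr01 R)) codeI measurableT mphi fE0)//.
apply: eq_eseriesr => k _; congr (_ * _)%E; apply: U_law.
by apply: measurableI => //; rewrite -[X in measurable X]setTI; exact: mphi.
Qed.

Lemma ae_schedule (A : set (state J)) :
  uniform_prob (@ltr01 R) (phi @^-1` A) = 1%E -> {ae P, forall w, A (phi (U w))}.
Proof.
move=> A1.
have mA : measurable (phi @^-1` A) by rewrite -[X in measurable X]setTI; exact: mphi.
have mUA : measurable (U @^-1` (phi @^-1` A)).
  by rewrite -[X in measurable X]setTI; exact: measurable_funP.
exists (~` (U @^-1` (phi @^-1` A))); split => //; first exact: measurableC.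
rewrite probability_setC// -A1 -(U_law mA) subee// fin_num_measure//.
Qed.

End maxweight_schedule.

Theorem theorem1 (R : realType) (J : finType)
    (* schedules *)
    (S : {fset state J})
    (S0 : ([ffun=> 0%N] : state J) \in S)
    (S_int : (hull (R := R) S)° !=set0)
    (* probability space, arrivals and uniform variables *)
    (d : measure_display) (T : measurableType d) (P : probability T R)
    (a : nat -> {RV P >-> state J}) (U : nat -> {RV P >-> R})
    (a_law : forall s t : nat, distribution P (a s) = distribution P (a t))
    (U_law : forall t (A : set R), measurable A ->
       distribution P (U t) A = uniform_prob (@ltr01 R) A)
    (aU_indep : independent P (fun i : nat + nat =>
       match i with inl t => sigma_of (a t) | inr t => sigma_of (U t) end))
    (abar : J -> R) (abar_gt0 : forall j, 0 < abar j)
    (a_mean : forall t j, ('E_P[fun w => (a t w j)%:R] = (abar j)%:E)%E)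
    (K : R)
    (a_var : forall t j, ('E_P[fun w => ((a t w j)%:R ^+ 2)%R] <= K%:E)%E)
    (* policy *)
    (alpha : R) (alpha_gt0 : 0 < alpha)
    (g : J -> R -> R)
    (g_incr : forall j, strictly_increasing_Rplus (g j))
    (g_diff : forall j, differentiable_Rplus (g j))
    (g_conc : forall j, strictly_concave_Rplus (g j))
    (phi : state J -> R -> state J)
    (phi_maxweight : maxweight alpha g S phi) :
  (hull S)° abar ->
  positive_recurrent P (queue phi a U).
Proof.
move=> abarI; have [mphi phi_supp phi_mean] := phi_maxweight.
have [c [c0 [C1 [e1 [C10 e10 drift]]]]] :=
  policy_drift alpha_gt0 abar_gt0 g_incr g_conc abarI.
have c_sum0 : 0 <= \sum_j c j by apply: sumr_ge0 => j _; exact: ltW.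
have [k k0 kP] : exists2 k, 0 < k &
    forall q : state J, lyapunov alpha c q `^ alpha <= k * \sum_j (q j)%:R `^ alpha.
  (* The summand 1 makes [k] positive even when [J] is empty. *)
  exists ((\sum_j c j) `^ (alpha / (1 + alpha)) + 1); first by rewrite ltr_wpDl// powR_ge0.
  move=> q; apply: le_trans (wnorm_powR_le alpha_gt0 c0 (fun j => ler0n _ _)) _.
  by rewrite ler_wpM2r ?lerDl// sumr_ge0// => j _; exact: powR_ge0.
have k8 : 0 < 8 * k by rewrite mulr_gt0.
(* The order of choice matters: [B] makes the truncation cost at most [e1 / (8 * k)], the constant
   [C] depends on [B], and [level] comes last, to make [C1 + C] negligible. *)
have [B B0 Dk] := exists_scale (wroot alpha c) K (divr_gt0 e10 k8).
have e0 : 0 < e1 / (2 * (1 + \sum_j c j)) by rewrite divr_gt0// mulr_gt0// ltr_wpDr.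
have [M pM] : exists M, forall (p : state J) j, p \in S -> (p j <= M)%N.
  exists (\sum_(p <- S) \sum_j p j)%N => p j pS.
  by rewrite (big_fsetD1 p)//= (bigD1 j)//= -addnA leq_addr.
have arr_mean j : (\int[P]_w (a 0%N w j)%:R%:E = (abar j)%:E)%E.
  by rewrite -(a_mean 0%N) unlock.
have arr_var j : (\int[P]_w ((a 0%N w j)%:R ^+ 2)%:E <= K%:E)%E.
  by have := a_var 0%N j; rewrite unlock.
have ma0 : measurable_fun setT (a 0%N) by exact: measurable_funP.
have msched q : measurable_fun setT (phi q \o U 0%N).
  by apply: measurableT_comp => //; exact: measurable_funP.
have sched_mean q (s : J -> R) :
    (forall j, ('E_(uniform_prob (@ltr01 R))[fun u => (phi q u j)%:R] = (s j)%:E)%E) ->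
    forall j, (\int[P]_w ((phi q \o U 0%N) w j)%:R%:E = (s j)%:E)%E.
  move=> sE j; rewrite -sE unlock.
  exact: (integral_schedule (U_law 0%N) (mphi q) (f := fun s : state J => (s j)%:R)).
have sched_le q : {ae P, forall w, forall j,
    ((phi q \o U 0%N) w j <= q j)%N /\ ((phi q \o U 0%N) w j <= M)%N}.
  apply: filterS (ae_schedule (U_law 0%N) (mphi q) (phi_supp q)) => w.
  move=> /imfsetP[p pS /= ->] j; rewrite ffunE; split; first exact: geq_minr.
  by rewrite geq_min pM.
have [C C0 bound] := lyapunov_serve alpha_gt0 c0 M B0 e0.
have mean_fin (q : state J) : (\int[P]_w (lyapunov alpha c
    (serve q ((phi q \o U 0%N) w) (a 0%N w)))%:E < +oo)%E.
  exact: lyapunov_mean_fin.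
have [eps eps0 epsE] : exists2 eps, 0 < eps & eps = e1 / (4 * k).
  by exists (e1 / (4 * k)) => //; rewrite divr_gt0// mulr_gt0.
have thr0 : 0 <= (C1 + C) * (8 * k / e1).
  by rewrite mulr_ge0 ?addr_ge0// ltW// divr_gt0.
have [level level0 levelP] : exists2 level, 0 <= level & forall v, level < v ->
    (C1 + C) * (8 * k / e1) <= v `^ alpha.
  exists (((C1 + C) * (8 * k / e1)) `^ alpha^-1); first exact: powR_ge0.
  by move=> v /ltW; exact: le_powR_root.
have mean_drift (q : state J) : level < lyapunov alpha c q ->
    (\int[P]_w (lyapunov alpha c (serve q ((phi q \o U 0%N) w) (a 0%N w)))%:E <=
    (lyapunov alpha c q - eps)%:E)%E.
  move=> q_large; have [s sopt sE] := phi_mean q.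
  have v0 : 0 < lyapunov alpha c q by exact: le_lt_trans q_large.
  have := lyapunov_mean_serve alpha_gt0 c0 (msched q) ma0 (sched_mean q s sE) arr_mean arr_var
    B0 e0 C0 v0 (bound q v0) (sched_le q).
  have EV0 : (0 <= \int[P]_w (lyapunov alpha c
      (serve q ((phi q \o U 0%N) w) (a 0%N w)))%:E)%E.
    by apply: integral_ge0 => w _; rewrite lee_fin lyapunov_ge0.
  have := mean_fin q; rewrite -(ge0_fin_numE EV0) => /fineK <-.
  rewrite !lee_fin epsE.
  apply: (negative_drift _ k0 e10 _ c_sum0 (kP q) (drift q s sopt) _ (levelP _ q_large) Dk).
  - exact: powR_gt0.
  - by apply: sumr_ge0 => j _; exact: powR_ge0.
  - rewrite mulr_sumr; apply: ler_sum => j _; rewrite ler_wpM2r ?powR_ge0//.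
    by rewrite (bigD1 j)//= lerDl; apply: sumr_ge0 => i _; exact: ltW.
(* Dividing by [eps] makes the drift one unit per step, the normalisation required of [W]. *)
have stepE (q : state J) : step (queue_kernel a_law U_law aU_indep mphi)
      (fun q' => (lyapunov alpha c q' / eps)%:E) q =
    ((eps^-1)%:E * \int[P]_w (lyapunov alpha c (serve q ((phi q \o U 0%N) w) (a 0%N w)))%:E)%E.
  rewrite step_queue; last by move=> y; rewrite lee_fin divr_ge0 ?lyapunov_ge0// ltW.
  rewrite -ge0_integralZl_EFin//.
  - by apply: eq_integral => w _; rewrite -EFinM mulrC.
  - by move=> w _; rewrite lee_fin lyapunov_ge0.
  - apply/measurable_EFinP; exact: measurable_lyapunov_serve.
  - by rewrite invr_ge0 ltW.
apply: (foster_positive_recurrent _ _ _ _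
  (queue_markov a_law U_law aU_indep mphi)
  (F := [set q | lyapunov alpha c q <= level])
  (W := fun q => (lyapunov alpha c q / eps)%:E)).
- by [].
- exact: countableP.
- by [].
- exact: (measurable_queue a_law U_law aU_indep mphi).
- exact: finite_lyapunov_level.
- by move=> q; rewrite lee_fin divr_ge0 ?lyapunov_ge0// ltW.
- move=> q; rewrite stepE lte_mul_pinfty// lee_fin invr_ge0 ltW//.
- move=> q /negP; rewrite -ltNge => q_large; rewrite stepE.
  apply: (@le_trans _ _ (1 + (eps^-1)%:E * (lyapunov alpha c q - eps)%:E)%E).
    rewrite leeD2l// lee_wpmul2l ?lee_fin ?invr_ge0 ?(ltW eps0)//.
    exact: mean_drift.
  rewrite -EFinM -EFinD lee_fin mulrBr mulVf ?gt_eqF// addrC subrK mulrC.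
  by [].
Qed.
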